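(* Let $G$ be a locally finite weakly connected digraph, let $s,t\in V(G)\cup\Omega(G)$ with $s\neq t$, and let $A\subseteq E(G)$. Then the following statements are equivalent: (i) $\overline{A}$ is a directed $s$--$t$ arc. (ii) $A$ is inclusion-wise minimal such that $|A\cap\overrightarrow{E}(X,Y)|\geq 1$ holds for every finite cut $E(X,Y)$ of $G$ with $s\in\overline{X}$ and $t\in\overline{Y}$. (iii) $A$ is inclusion-wise minimal such that $|A\cap\overrightarrow{E}(X,Y)| = |A\cap\overrightarrow{E}(Y,X)|+1$ holds for every finite cut $E(X,Y)$ of $G$ with $s\in\overline{X}$ and $t\in\overline{Y}$.
   Context: Digraphs may be infinite and may have parallel edges but no loops. A digraph is weakly connected (locally finite) if its underlying undirected multigraph is connected (has only finite degrees). For disjoint $X,Y\subseteq V(G)$, $\overrightarrow{E}(X,Y)$ is the set of edges with tail in $X$ and head in $Y$, and $E(X,Y)=\overrightarrow{E}(X,Y)\cup\overrightarrow{E}(Y,X)$; it is a cut if $(X,Y)$ is a bipartition of $V(G)$ (with non-empty classes). Ends: a ray is a one-way infinite undirected path; two rays in a multigraph are equivalent if they cannot be separated by finitely many vertices, and the equivalence classes are the ends. The ends of $G$, forming the set $\Omega(G)$, are those of its underlying multigraph $H$. The space $|G|$: for a locally finite weakly connected digraph $G$ with underlying multigraph $H$, $|G|:=|H|$ is the Freudenthal compactification of the $1$-complex of $H$. Its points are the points of the $1$-complex (each edge being a copy of $[0,1]$ joining its endvertices) together with the ends. Points of the $1$-complex have their usual basic neighbourhoods; basic open neighbourhoods of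 an end $\omega$ are given by finite sets $S\subseteq V$ and consist of the component $C$ of $H-S$ in which $\omega$ has a ray, all ends with a ray in $C$, and, for every edge between $C$ and $S$, a half-open partial edge at its endvertex in $C$ (of length $\varepsilon$ for some $\varepsilon\in(0,1]$). $\mathring{e}$ denotes the set of inner points of an edge $e$. For a point set, vertex set, edge set or subgraph $Z$, $\overline{Z}$ is the closure in $|G|$ of the set of points corresponding to $Z$. For $X\subseteq V(G)$, $\overline{X}$ is $X$ together with all ends containing a ray that cannot be separated from $X$ by finitely many vertices. Directed arcs: an arc in $|G|$ is the image of a homeomorphism $\sigma$ from $[0,1]$ onto a subspace of $|G|$. Each edge $e=uv$ (tail $u$, head $v$) carries the linear order $<_e$ on $\overline{\{e\}}$ induced by any homeomorphism $\varphi_e:[0,1]\to\overline{\{e\}}$ with $\varphi_e(0)=u$, $\varphi_e(1)=v$. A directed $s$--$t$ arc is an arc for which such a $\sigma$ can be chosen with $\sigma(0)=s$, $\sigma(1)=t$ and such that for every edge $e$ with $\mathring{e}$ meeting the arc, the order that $\sigma$ induces on the points of $\mathring{e}$ in the arc ($p<q$ iff $\sigma^{-1}(p)<\sigma^{-1}(q)$) agrees with $<_e$. *)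

(* Defs.v *)
From HB Require Import structures.
From mathcomp Require Import all_boot all_order all_algebra finmap.
From mathcomp Require Import boolp classical_sets functions cardinality.
From mathcomp Require Import set_interval reals topology normedtype.
Set Implicit Arguments.
Unset Strict Implicit.
Unset Printing Implicit Defensive.
Import Order.TTheory GRing.Theory Num.Theory.
Import numFieldNormedType.Exports.
Local Open Scope classical_set_scope.
Local Open Scope ring_scope.

(* Parallel edges are allowed. The choiceType structures are no restriction,
   since every type has one by gen_eqMixin and gen_choiceMixin. *)
Record digraph := Digraph {
  vertex :> choiceType;
  edge : choiceType;
  etail : edge -> vertex;
  ehead : edge -> vertex;
  loopless : forall e, etail e <> ehead e }.

Section Digraph.
Variable G : digraph.
Implicit Types (u v w : G) (e : edge G) (S C X Y : set G).

Definition joins e u v : Prop :=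
  (etail e = u /\ ehead e = v) \/ (etail e = v /\ ehead e = u).

(* [connected_off S u v]: the underlying multigraph minus S contains a
   u--v path. *)
Inductive connected_off S u : G -> Prop :=
| connected_off_refl : ~ S u -> connected_off S u u
| connected_off_step v w e :
    connected_off S u v -> joins e v w -> ~ S w -> connected_off S u w.

Definition weakly_connected : Prop := forall u v, connected_off set0 u v.

Definition locally_finite : Prop :=
  forall v, finite_set [set e | etail e = v \/ ehead e = v].

Definition dedges X Y : set (edge G) := [set e | X (etail e) /\ Y (ehead e)].

Definition uedges X Y : set (edge G) := dedges X Y `|` dedges Y X.

Definition bipartition X Y : Prop :=
  [/\ X !=set0, Y !=set0, X `&` Y = set0 & X `|` Y = setT].

Definition finite_cut X Y : Prop :=
  bipartition X Y /\ finite_set (uedges X Y).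

Record ray := Ray {
  ray_vertex : nat -> G;
  ray_edge : nat -> edge G;
  ray_injective : injective ray_vertex;
  ray_joins : forall n, joins (ray_edge n) (ray_vertex n) (ray_vertex n.+1) }.

(* The set S separates two rays if it meets every path from one to the other;
   rays that no finite S separates are equivalent. *)
Definition ray_equiv (r r' : ray) : Prop :=
  forall S, finite_set S ->
    exists m n, connected_off S (ray_vertex r m) (ray_vertex r' n).

Definition gend := {w : set ray | exists r, w = [set r' | ray_equiv r r']}.

Definition is_component S C : Prop :=
  exists2 u, ~ S u & C = [set v | connected_off S u v].

Definition end_in (w : gend) C : Prop :=
  exists2 r, sval w r & forall n, C (ray_vertex r n).

End Digraph.

Section FreudenthalSpace.
Variables (R : realType) (G : digraph).

(* The inner points of e are those at parameter 0 < x < 1, running from the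
   tail to the head. *)
Inductive fpoint : Type :=
| Vertex of G
| Inner of edge G & {x : R | 0 < x < 1}
| End of gend G.

HB.instance Definition _ := gen_eqMixin fpoint.
HB.instance Definition _ := gen_choiceMixin fpoint.

Definition star v (eps : R) : set fpoint := [set p |
  match p with
  | Vertex u => u = v
  | Inner e x =>
      (etail e = v /\ val x < eps) \/ (ehead e = v /\ 1 - eps < val x)
  | End _ => False
  end].

Definition edge_ball (e : edge G) (x eps : R) : set fpoint := [set p |
  match p with
  | Inner e' y => e' = e /\ `|val y - x| < eps
  | _ => False
  end].

(* The component C of the graph minus S, the ends with a ray in C, and the
   half-open partial edges of length eps at C of the edges between C and S. *)
Definition end_nbhd (S C : set G) (eps : R) : set fpoint := [set p |
  match p with
  | Vertex u => C u
  | Inner e x => [\/ C (etail e) /\ C (ehead e),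
                     [/\ C (etail e), S (ehead e) & val x < eps] |
                     [/\ S (etail e), C (ehead e) & 1 - eps < val x]]
  | End w => end_in w C
  end].

Definition basic_nbhd (p : fpoint) (B : set fpoint) : Prop :=
  match p with
  | Vertex v => exists2 eps : R, 0 < eps <= 1 & B = star v eps
  | Inner e x => exists2 eps : R, 0 < eps & B = edge_ball e (val x) eps
  | End w => exists S C (eps : R),
      [/\ finite_set S, is_component S C, end_in w C, 0 < eps <= 1 &
          B = end_nbhd S C eps]
  end.

Definition fopen (U : set fpoint) : Prop :=
  forall p, U p -> exists2 B, basic_nbhd p B & B `<=` U.

End FreudenthalSpace.

Arguments Vertex {R G}.
Arguments Inner {R G}.
Arguments End {R G}.

Section Topology.
Variables (R : realType) (G : digraph).
Implicit Types (S C : set G).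

Lemma connected_offP S (u v : G) : connected_off S u v -> ~ S u /\ ~ S v.
Proof. by elim=> [//|x y e _ [? _] _ ?]. Qed.

Lemma connected_off_trans S (u v w : G) :
  connected_off S u v -> connected_off S v w -> connected_off S u w.
Proof.
move=> uv; elim=> [//|x y e _ ux xy Sy].
exact: connected_off_step xy Sy.
Qed.

Lemma joinsC (e : edge G) u v : joins e u v -> joins e v u.
Proof. by case=> [[<- <-]|[<- <-]]; [right|left]. Qed.

Lemma connected_off_sym S (u v : G) :
  connected_off S u v -> connected_off S v u.
Proof.
elim=> [Su|x y e ux xu xy Sy]; first exact: connected_off_refl.
have [_ Sx] := connected_offP ux.
apply: connected_off_trans xu.
by apply: connected_off_step (joinsC xy) Sx; exact: connected_off_refl.
Qed.

Lemma connected_off_sub S S' (u v : G) :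
  S `<=` S' -> connected_off S' u v -> connected_off S u v.
Proof.
move=> SS'; elim=> [Su|x y e _ ux xy Sy].
  by apply: connected_off_refl => /SS'.
by apply: connected_off_step xy _ => // /SS'.
Qed.

Definition ray_shift (r : ray G) (k : nat) : ray G.
Proof.
exists (fun n => ray_vertex r (k + n)) (fun n => ray_edge r (k + n)).
- by move=> m n /ray_injective /addnI.
- by move=> n; rewrite addnS; exact: ray_joins.
Defined.

Lemma ray_avoid (r : ray G) S : finite_set S ->
  exists k, forall n, ~ S (ray_vertex r (k + n)).
Proof.
move=> fS.
have : finite_set (ray_vertex r @^-1` S).
  by apply: finite_preimage fS => m n _ _; exact: ray_injective.
case/finite_seqP => F FE.
exists (\max_(i <- F) i).+1 => n Sn.
have : (ray_vertex r @^-1` S) ((\max_(i <- F) i).+1 + n)%N by [].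
rewrite FE /= => inF.
have := @leq_bigmax_seq _ F xpredT id _ inF isT.
by rewrite addSn ltnNge leq_addr.
Qed.

Lemma ray_connected (r : ray G) S k :
  (forall n, ~ S (ray_vertex r (k + n))) ->
  forall n, connected_off S (ray_vertex r k) (ray_vertex r (k + n)).
Proof.
move=> kS; elim=> [|n IH].
  by rewrite addn0; apply: connected_off_refl; rewrite -[k]addn0.
rewrite addnS; apply: connected_off_step IH (ray_joins r _) _.
by rewrite -addnS.
Qed.

Lemma is_component_joins S C (e : edge G) u v : is_component S C ->
  joins e u v -> C u -> ~ S v -> C v.
Proof. by move=> [x _ ->] /= uv xu Sv; exact: connected_off_step xu uv Sv. Qed.

Lemma end_nbhd_shrink (w : gend G) S1 C1 S2 C2 :
  finite_set S1 -> finite_set S2 ->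
  is_component S1 C1 -> is_component S2 C2 ->
  end_in w C1 -> end_in w C2 ->
  exists C, [/\ is_component (S1 `|` S2) C, end_in w C, C `<=` C1 & C `<=` C2].
Proof.
move=> fS1 fS2 cC1 cC2; case: w => W [r0 EW] /= [r1 /= Wr1 r1C] [r2 /= Wr2 r2C].
have fS : finite_set (S1 `|` S2) by rewrite finite_setU.
have [k kS] := ray_avoid r0 fS.
have kc := ray_connected kS.
pose C := [set v | connected_off (S1 `|` S2) (ray_vertex r0 k) v].
have sub S' C' r' : S' `<=` S1 `|` S2 -> finite_set S' -> is_component S' C' ->
    ray_equiv r0 r' -> (forall n, C' (ray_vertex r' n)) -> C `<=` C'.
  move=> S'S fS' [x Sx ->] r0r' r'C v Cv /=.
  have fT : finite_set (S' `|` ray_vertex r0 @` `I_k).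
    by rewrite finite_setU; split=> //; exact/finite_image/finite_II.
  have [m [n mn]] := r0r' _ fT.
  have km : (k <= m)%N.
    rewrite leqNgt; apply/negP => mk; case: (connected_offP mn) => + _.
    by apply; right; exists m.
  apply: connected_off_trans (r'C n) _.
  have subT : S' `<=` S' `|` ray_vertex r0 @` `I_k by move=> ? ?; left.
  apply: connected_off_trans (connected_off_sym (connected_off_sub subT mn)) _.
  apply: (connected_off_sub S'S); apply: connected_off_trans Cv.
  by apply: connected_off_sym; rewrite -(subnKC km); exact: kc.
exists C; split.
- by exists (ray_vertex r0 k) => //; rewrite -[k]addn0.
- exists (ray_shift r0 k) => /=; last exact: kc.
  rewrite EW /= => S' fS'; have [j jS'] := ray_avoid r0 fS'.
  exists (j + k)%N, j => /=; rewrite [(k + j)%N]addnC.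
  exact: connected_off_refl.
- by apply: (@sub S1 C1 r1) => //; move: Wr1; rewrite EW.
- by apply: (@sub S2 C2 r2) => //; move: Wr2; rewrite EW.
Qed.

Lemma end_nbhd_sub S C S' C' (d d' : R) : S' `<=` S -> is_component S' C' ->
  C `<=` C' -> d <= d' ->
  end_nbhd S C d `<=` end_nbhd S' C' d'.
Proof.
move=> S'S cC' CC' dd' [u|e x|w] /=; first exact: CC'.
- have [Ct|nt] := pselect (C' (etail e));
  have [Ch|nh] := pselect (C' (ehead e)).
  + by move=> _; exact: Or31.
  + case=> [[_ /CC']//|[Ct' Sh xd]|[_ /CC']//].
    apply: Or32; split=> //; last exact: lt_le_trans xd dd'.
    by apply: contrapT => nS; apply: nh;
      apply: (is_component_joins cC' _ Ct nS); left.
  + case=> [[/CC']//|[/CC']//|[St Ch' xd]].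
    apply: Or33; split=> //; last by apply: le_lt_trans xd; rewrite lerB.
    by apply: contrapT => nS; apply: nt;
      apply: (is_component_joins cC' _ Ch nS); right.
  + by case=> [[/CC']//|[/CC']//|[_ /CC']].
- by move=> [r wr rC]; exists r => // n; exact/CC'.
Qed.

Lemma basic_nbhdI (p : fpoint R G) B1 B2 : basic_nbhd p B1 -> basic_nbhd p B2 ->
  exists2 B, basic_nbhd p B & B `<=` B1 `&` B2.
Proof.
case: p => [v|e x|w] /=.
- move=> [d1 /andP[d10 d11] ->] [d2 /andP[d20 d21] ->].
  exists (star v (Num.min d1 d2)).
    by exists (Num.min d1 d2) => //; rewrite lt_min d10 d20 ge_min d11.
  move=> [u|e x|w] //= [[te]|[he xd]].
    by rewrite lt_min => /andP[x1 x2]; split; left.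
  by split; right; split=> //; apply: le_lt_trans xd;
    rewrite lerB // ge_min lexx ?orbT.
- move=> [d1 d10 ->] [d2 d20 ->].
  exists (edge_ball e (val x) (Num.min d1 d2)).
    by exists (Num.min d1 d2) => //; rewrite lt_min d10.
  by move=> [u|e' y|w] //= [->]; rewrite lt_min => /andP[].
- move=> [S1 [C1 [d1 [fS1 cC1 wC1 /andP[d10 d11] ->]]]].
  move=> [S2 [C2 [d2 [fS2 cC2 wC2 /andP[d20 d21] ->]]]].
  have [C [cC wC CC1 CC2]] := end_nbhd_shrink fS1 fS2 cC1 cC2 wC1 wC2.
  exists (end_nbhd (S1 `|` S2) C (Num.min d1 d2)).
    exists (S1 `|` S2), C, (Num.min d1 d2); split=> //.
    - by rewrite finite_setU.
    - by rewrite lt_min d10 d20 ge_min d11.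
  rewrite subsetI; split; apply: end_nbhd_sub => //.
  + by rewrite ge_min lexx.
  + by rewrite ge_min lexx orbT.
Qed.

End Topology.

Section FreudenthalTopology.
Variables (R : realType) (G : digraph).

Let fopenT : fopen [set: fpoint R G].
Proof.
move=> [v|e x|w] _ /=.
- by exists (star v 1) => //; exists 1 => //; rewrite ltr01 lexx.
- by exists (edge_ball e (val x) 1) => //; exists 1.
- case: w => W [r EW].
  have [k k0] := ray_avoid r (@finite_set0 G).
  pose C := [set v | connected_off set0 (ray_vertex r 0%N) v].
  exists (end_nbhd set0 C 1) => //; exists set0, C, 1; split=> //.
  + by exists (ray_vertex r 0%N).
  + exists r => [|n]; last exact: (@ray_connected _ r set0 0%N).
    rewrite /= EW /= => S fS; have [j jS] := ray_avoid r fS.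
    by exists j, j; apply: connected_off_refl; have := jS 0%N; rewrite addn0.
  + by rewrite ltr01 lexx.
Qed.

Let fopenI : setI_closed (@fopen R G).
Proof.
move=> U1 U2 o1 o2 p [/o1[B1 pB1 BU1] /o2[B2 pB2 BU2]].
have [B pB BB] := basic_nbhdI pB1 pB2.
by exists B => // q /BB[/BU1 ? /BU2].
Qed.

Let fopen_bigU (I : Type) (f : I -> set (fpoint R G)) :
  (forall i, fopen (f i)) -> fopen (\bigcup_i f i).
Proof.
move=> of_ p [i _ /of_[B pB Bf]]; exists B => // q /Bf fq.
by exists i.
Qed.

HB.instance Definition _ :=
  isOpenTopological.Build (fpoint R G) fopenT fopenI fopen_bigU.

End FreudenthalTopology.

Section Arcs.
Variables (R : realType) (G : digraph).
Implicit Types (e : edge G) (p q s t : fpoint R G).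

Definition VOmega : set (fpoint R G) := range Vertex `|` range End.

Definition vclosure (X : set G) : set (fpoint R G) := closure (Vertex @` X).

(* A homeomorphism from [0,1] onto the closure of e, from tail to head. *)
Definition edge_pt e (x : R) : fpoint R G :=
  if (insub x : option {x : R | 0 < x < 1}) is Some y then Inner e y
  else Vertex (if x <= 0 then etail e else ehead e).

Definition edge_lt e p q : Prop := exists x y,
  [/\ 0 <= x, x < y, y <= 1, p = edge_pt e x & q = edge_pt e y].

Definition eclosure (A : set (edge G)) : set (fpoint R G) :=
  closure (\bigcup_(e in A) edge_pt e @` `[0, 1]).

(* sigma restricts to a homeomorphism from [0,1] onto the subspace P, whose
   inverse is the restriction of rho. *)
Definition homeo_unit_itv (T : topologicalType) (sigma : R -> T) (rho : T -> R)
    (P : set T) : Prop :=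
  [/\ sigma @` `[0, 1] = P, {in `[0, 1], cancel sigma rho},
      {within `[0, 1], continuous sigma} & {within P, continuous rho}].

Definition directed_arc s t (P : set (fpoint R G)) : Prop :=
  exists (sigma : R -> fpoint R G) (rho : fpoint R G -> R),
    [/\ homeo_unit_itv sigma rho P, sigma 0 = s, sigma 1 = t &
        forall e p q, (P `&` range (Inner e)) p -> (P `&` range (Inner e)) q ->
          (rho p < rho q <-> edge_lt e p q)].

End Arcs.

Arguments VOmega : clear implicits.
Arguments vclosure R {G} X.
Arguments eclosure R {G} A.

Definition incl_minimal (T : Type) (Q : set T -> Prop) (A : set T) : Prop :=
  Q A /\ forall B, B `<=` A -> Q B -> B = A.

Definition ecard (T : choiceType) (A : set T) : nat := #|` fset_set A|.

(* Only edges of finite cuts are counted, so the junk value that ecard has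
   on infinite sets does not occur. *)
Definition meets_cuts (R : realType) (G : digraph) (s t : fpoint R G)
    (A : set (edge G)) : Prop :=
  forall X Y : set G, finite_cut X Y -> vclosure R X s -> vclosure R Y t ->
    (1 <= ecard (A `&` dedges X Y))%N.

Definition balances_cuts (R : realType) (G : digraph) (s t : fpoint R G)
    (A : set (edge G)) : Prop :=
  forall X Y : set G, finite_cut X Y -> vclosure R X s -> vclosure R Y t ->
    ecard (A `&` dedges X Y) = (ecard (A `&` dedges Y X) + 1)%N.

(* Main.v *)
Require Import Defs.
From mathcomp Require Import all_boot all_order all_algebra finmap.
From mathcomp Require Import boolp classical_sets functions cardinality.
From mathcomp Require Import set_interval reals topology normedtype.
From mathcomp Require Import sequences derive ring lra.

(* A set A that is minimal with the property of leaving X for every finite cut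
   (X, ~X) from s to t has, for each edge e in A, a cut X_e that e leaves and that
   no other edge of A crosses. Submodularity (passing to intersections and unions
   of cuts) shows that the X_e are nested as far as A can see, which orders A.
   Every finite cut X yields a continuous function on |G| that is 0 on X, 1 off X
   and affine on edges; a weighted sum h of the functions of the X_e is injective
   and monotone along A, and its image of the compact set cl(A) is order-dense,
   hence an interval. The inverse of h is the directed arc. For balancedness, an
   edge of A that crosses X backwards splits X into X n X_e and X u X_e, each
   crossed by fewer edges of A.
   Conversely, the last point of an arc at height 1/2 of the function of X lies on
   an edge that leaves X. By Zorn's lemma the set A of the arc contains a minimal
   one, whose closure is a subarc with the same ends, hence the whole arc; Zorn's
   lemma also reduces (iii) to (ii). *)

Set Implicit Arguments.
Unset Strict Implicit.
Unset Printing Implicit Defensive.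
Import Order.TTheory GRing.Theory Num.Theory.
Import numFieldNormedType.Exports.
Local Open Scope classical_set_scope.
Local Open Scope ring_scope.

(** * Finite cuts, rays and ends *)

Section Boundary.
Variable G : digraph.
Implicit Types (X Y S : set G) (e : edge G) (r : ray G).

Definition boundary X : set (edge G) := uedges X (~` X).

Lemma boundaryE X e :
  boundary X e <-> ~ (X (etail e) <-> X (ehead e)).
Proof.
rewrite /boundary /uedges /dedges /setC /=.
by have := EM (X (etail e)); have := EM (X (ehead e)); tauto.
Qed.

Lemma boundaryC X : boundary (~` X) = boundary X.
Proof. by rewrite /boundary /uedges setCK setUC. Qed.

Lemma boundaryI X Y : boundary (X `&` Y) `<=` boundary X `|` boundary Y.
Proof.
move=> e /boundaryE ne; apply: contrapT => /not_orP[].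
by rewrite !boundaryE => /contrapT ? /contrapT ?; apply: ne => /=; tauto.
Qed.

Definition fin_bd X := finite_set (boundary X).

Lemma fin_bdC X : fin_bd X -> fin_bd (~` X).
Proof. by rewrite /fin_bd boundaryC. Qed.

Lemma fin_bdI X Y : fin_bd X -> fin_bd Y -> fin_bd (X `&` Y).
Proof.
by move=> fX fY; apply: sub_finite_set (@boundaryI X Y) _; rewrite finite_setU.
Qed.

Lemma fin_bdU X Y : fin_bd X -> fin_bd Y -> fin_bd (X `|` Y).
Proof.
move=> fX fY; rewrite -[_ `|` _]setCK setCU.
by apply/fin_bdC/fin_bdI; exact/fin_bdC.
Qed.

Lemma fin_bd_finite S : locally_finite G -> finite_set S -> fin_bd S.
Proof.
move=> lf fS.
apply: (@sub_finite_set _ _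
  (\bigcup_(v in S) [set e | etail e = v \/ ehead e = v])).
  by move=> e [[Se _]|[_ Se]]; [exists (etail e)|exists (ehead e)] => //;
    [left|right].
by apply: bigcup_finite => // v _; exact: lf.
Qed.

(** An edge leaving a component of the graph minus [S] must end in [S], and only finitely many edges
    touch [S]. *)
Lemma fin_bd_component S X :
  locally_finite G -> finite_set S -> is_component S X -> fin_bd X.
Proof.
move=> lf fS cX.
apply: sub_finite_set (fin_bd_finite lf fS) => e.
have key u v : joins e u v -> X u -> ~ X v -> boundary S e.
  move=> j Xu Xv; have Sv : S v.
    by apply: contrapT => Sv; apply: Xv; exact: is_component_joins cX j Xu Sv.
  have Su : ~ S u.
    by case: cX Xu => x _ -> xu; case: (connected_offP xu).
  apply/boundaryE; case: j => -[<- <-] in Su Sv *; tauto.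
by move=> [[/= ? ?]|[/= ? ?]]; [apply: (@key (etail e) (ehead e))|
  apply: (@key (ehead e) (etail e))] => //; [left|right].
Qed.

Definition bd_ends X : set G := (@etail G) @` boundary X `|` (@ehead G) @` boundary X.

Lemma bd_ends_finite X : fin_bd X -> finite_set (bd_ends X).
Proof. by move=> fX; rewrite finite_setU; split; exact: finite_image. Qed.

Lemma connected_off_bd X S (u v : G) : bd_ends X `<=` S ->
  connected_off S u v -> X u <-> X v.
Proof.
move=> bS; elim=> // x y e ux IH j Sy; rewrite IH.
have [_ Sx] := connected_offP ux.
suff : ~ boundary X e by rewrite boundaryE => /contrapT; case: j => -[<- <-]; tauto.
move=> be; apply: Sy; apply: bS.
by case: j => [[_ <-]|[<- _]]; [right|left]; exists e.
Qed.

(** A tail of the ray avoids the finitely many endvertices of boundary edges and so never changes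
    sides; this is what gives an end a side of a finite cut. *)
Lemma ray_side X r : fin_bd X -> exists k,
  (forall n, X (ray_vertex r (k + n))) \/ (forall n, ~ X (ray_vertex r (k + n))).
Proof.
move=> fX; have [k kS] := ray_avoid r (bd_ends_finite fX).
exists k; have E n := connected_off_bd (@subset_refl _ _) (ray_connected kS n).
by case: (EM (X (ray_vertex r k))) => H; [left|right] => n; move: (E n); tauto.
Qed.

Lemma ray_equiv_refl r : ray_equiv r r.
Proof.
move=> S fS; have [j jS] := ray_avoid r fS.
by exists j, j; apply: connected_off_refl; have := jS 0%N; rewrite addn0.
Qed.

Lemma ray_equiv_sym r r' : ray_equiv r r' -> ray_equiv r' r.
Proof.
by move=> rr' S /rr'[m [n mn]]; exists n, m; exact: connected_off_sym.
Qed.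

(** The separator is enlarged by an initial segment of [r2], which forces both connections to reach
    [r2] in a tail avoiding [S]; that tail links them. *)
Lemma ray_equiv_trans r1 r2 r3 :
  ray_equiv r1 r2 -> ray_equiv r2 r3 -> ray_equiv r1 r3.
Proof.
move=> r12 r23 S fS; have [k kS] := ray_avoid r2 fS.
have fT : finite_set (S `|` ray_vertex r2 @` `I_k).
  by rewrite finite_setU; split=> //; exact/finite_image/finite_II.
have [m [n mn]] := r12 _ fT; have [n' [l nl]] := r23 _ fT.
have ge i : ~ (S `|` ray_vertex r2 @` `I_k) (ray_vertex r2 i) -> (k <= i)%N.
  move=> h; rewrite leqNgt; apply/negP => ik; apply: h; right.
  by exists i.
have kn : (k <= n)%N by apply: ge; case: (connected_offP mn).
have kn' : (k <= n')%N by apply: ge; case: (connected_offP nl).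
have sub : S `<=` S `|` ray_vertex r2 @` `I_k by move=> ? ?; left.
exists m, l; apply: connected_off_trans (connected_off_sub sub mn) _.
apply: connected_off_trans (connected_off_sub sub nl).
apply: connected_off_trans.
  by apply/connected_off_sym; rewrite -(subnKC kn); exact: ray_connected.
by rewrite -(subnKC kn'); exact: ray_connected.
Qed.

Lemma ray_equiv_shift r k : ray_equiv r (ray_shift r k).
Proof.
move=> S fS; have [j jS] := ray_avoid r fS.
exists (j + k)%N, j => /=; rewrite [(k + j)%N]addnC.
exact: connected_off_refl.
Qed.

Lemma gend_inhab (w : gend G) : exists r, sval w r.
Proof. by case: w => W [r /= ->]; exists r; exact: ray_equiv_refl. Qed.

Lemma gend_equiv (w : gend G) r r' : sval w r -> sval w r' <-> ray_equiv r r'.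
Proof.
case: w => W [r0 /= ->] /= r0r; split=> [r0r'|]; last exact: ray_equiv_trans r0r.
exact: ray_equiv_trans (ray_equiv_sym r0r) r0r'.
Qed.

Lemma gend_eq (w w' : gend G) r : sval w r -> sval w' r -> w = w'.
Proof.
move=> wr w'r; have : sval w = sval w'.
  by apply/seteqP; split=> r'; rewrite (gend_equiv _ wr) (gend_equiv _ w'r).
case: w w' {wr w'r} => [W HW] [W' HW'] /= WW'; case: _ / WW' in HW' *.
by congr exist; exact: Prop_irrelevance.
Qed.

Definition ray_end r : gend G := exist _ [set r' | ray_equiv r r'] (ex_intro _ r erefl).

Lemma end_in_tail (w : gend G) r k X : sval w r ->
  (forall n, X (ray_vertex r (k + n))) -> end_in w X.
Proof.
move=> wr rX; exists (ray_shift r k) => //.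
by rewrite (gend_equiv _ wr); exact: ray_equiv_shift.
Qed.

Lemma end_in_excl (w : gend G) X : fin_bd X -> end_in w X -> ~ end_in w (~` X).
Proof.
move=> fX [r wr rX] [r' wr' r'X].
move: (wr'); rewrite (gend_equiv _ wr) => /(_ _ (bd_ends_finite fX))[m [n mn]].
by apply: (r'X n); rewrite -(connected_off_bd (@subset_refl _ _) mn).
Qed.

Lemma end_in_ray (w : gend G) X r : fin_bd X -> end_in w X -> sval w r ->
  exists k, forall n, X (ray_vertex r (k + n)).
Proof.
move=> fX wX wr; have [k [rX|rX]] := ray_side r fX; first by exists k.
by case: (end_in_excl fX wX); exact: end_in_tail rX.
Qed.

End Boundary.

(** * Sides of a finite cut at vertices and ends *)

Section Side.
Variables (R : realType) (G : digraph).
Implicit Types (p q : fpoint R G) (X Y : set G).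

(** For finite cuts and points of [VOmega] this is a topology-free substitute for lying in the
    closure of [X]; see [vclosureE]. *)
Definition side p X : Prop :=
  match p with
  | Vertex v => X v
  | Inner _ _ => False
  | End w => end_in w X
  end.

Lemma side_sub p X Y : X `<=` Y -> side p X -> side p Y.
Proof.
case: p => [v|//|w] /= XY; first exact: XY.
by move=> [r wr rX]; exists r => // n; exact: XY.
Qed.

Lemma side_excl p X : fin_bd X -> side p X -> ~ side p (~` X).
Proof. by case: p => [v _ /= ? /(_ _)//|//|w] /=; exact: end_in_excl. Qed.

Lemma side_total p X : VOmega R G p -> fin_bd X -> side p X \/ side p (~` X).
Proof.
move=> + fX; case: p => [v _|e x [[]//|[]//]|w _] /=; first exact: EM.
have [r wr] := gend_inhab w.
by have [k [rX|rX]] := ray_side r fX; [left|right]; exact: end_in_tail rX.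
Qed.

Lemma sideI p X Y : fin_bd X -> fin_bd Y -> side p X -> side p Y ->
  side p (X `&` Y).
Proof.
case: p => [v|//|w] //= fX fY wX wY; have [r wr] := gend_inhab w.
have [k kX] := end_in_ray fX wX wr; have [l lY] := end_in_ray fY wY wr.
apply: (@end_in_tail _ _ _ (k + l)%N) wr _ => n; split.
  by rewrite -addnA; exact: kX.
by rewrite [(k + l)%N]addnC -addnA; exact: lY.
Qed.

Lemma side_neq0 p X : side p X -> X !=set0.
Proof.
case: p => [v|//|w] /=; first by exists v.
by move=> [r _ /(_ 0%N)]; exists (ray_vertex r 0).
Qed.

(** A vertex is cut off by its own singleton, and two ends by a component left after deleting a
    finite separator of their rays. *)
Lemma side_separation p q : locally_finite G -> VOmega R G p -> VOmega R G q ->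
  p <> q -> exists X, [/\ fin_bd X, side p X & side q (~` X)].
Proof.
move=> lf pV qV pq.
have vtx v q' : VOmega R G q' -> Vertex v <> q' ->
    exists X, [/\ fin_bd X, side (@Vertex R G v) X & side q' (~` X)].
  move=> q'V vq'; have fv := fin_bd_finite lf (finite_set1 v).
  exists [set v]; split=> //; have [|//] := side_total q'V fv.
  case: q' {q'V} vq' => [u /= + uv|//|w _ [r _ rv]]; first by rewrite uv.
  by have /ray_injective : ray_vertex r 0%N = ray_vertex r 1%N by rewrite !rv.
case: p pV pq => [v|e x [[]//|[]//]|w] pV pq; first exact: vtx.
case: q qV pq => [u|e x [[]//|[]//]|w'] qV pq.
  have [||X [fX uX wX]] := vtx u (End w) => //.
  by exists (~` X); rewrite setCK; split=> //; exact: fin_bdC.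
have [r wr] := gend_inhab w; have [r' wr'] := gend_inhab w'.
have : ~ ray_equiv r r'.
  rewrite -(gend_equiv _ wr) => wr''; apply: pq; congr End.
  exact: gend_eq wr'' wr'.
move=> /existsNP[S /not_implyP[fS nS]].
have [k kS] := ray_avoid r fS.
pose C := [set v | connected_off S (ray_vertex r k) v].
have cC : is_component S C by exists (ray_vertex r k) => //; rewrite -[k]addn0.
have fC := fin_bd_component lf fS cC.
exists C; split=> //=.
  by apply: (end_in_tail wr); exact: ray_connected.
case: (side_total qV fC) => // /= w'C.
have [l lC] := end_in_ray fC w'C wr'.
by case: nS; exists k, l; rewrite -[l]addn0; exact: lC.
Qed.

End Side.

(** * Edge sets meeting all s-t cuts *)

(** Supplies the chain condition in [hits_minimal]: only finitely many edges leave a finite cut, so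
    a chain of deletions cannot remove them all unless one member does. *)
Lemma chain_cover_finite (T : choiceType) (F : set (set T)) (D Y0 : set T) :
  total_on F subset -> F Y0 -> finite_set D -> D `<=` \bigcup_(Y in F) Y ->
  exists2 Y, F Y & D `<=` Y.
Proof.
move=> tot FY0 /finite_seqP[l ->]; elim: l => [|x l IH] lF.
  by exists Y0.
have [y yl|Y FY lY] := IH; first by apply: lF; rewrite /= in_cons yl orbT.
have [|Z FZ Zx] := lF x; first by rewrite /= mem_head.
have [YZ|ZY] := tot _ _ FY FZ.
  exists Z => // y; rewrite /= in_cons => /orP[/eqP->//|yl].
  exact/YZ/lY.
exists Y => // y; rewrite /= in_cons => /orP[/eqP->|]; last exact: lY.
exact: ZY.
Qed.

Section Hitting.
Variables (R : realType) (G : digraph) (s t : fpoint R G).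
Implicit Types (A B : set (edge G)) (X Y : set G) (e f g : edge G).

Definition st_cut X := [/\ fin_bd X, side s X & side t (~` X)].

Definition leaves X e := X (etail e) /\ ~ X (ehead e).

(** The cut condition of (ii), with each cut given by one side; [meets_cutsE] makes the link. *)
Definition hits A := forall X, st_cut X -> exists2 e, A e & leaves X e.

Lemma leaves_boundary X e : leaves X e -> boundary X e.
Proof. by move=> [? ?]; apply/boundaryE; tauto. Qed.

Lemma st_cutI X Y : st_cut X -> fin_bd Y -> side s Y -> st_cut (X `&` Y).
Proof.
move=> [fX sX tX] fY sY; split; [exact: fin_bdI|exact: sideI|].
by apply: side_sub tX => v Xv [].
Qed.

Lemma st_cutU X Y : st_cut X -> fin_bd Y -> side t (~` Y) -> st_cut (X `|` Y).
Proof.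
move=> [fX sX tX] fY tY; split; first exact: fin_bdU.
  by apply: side_sub sX => v; left.
by rewrite setCU; apply: sideI => //; exact: fin_bdC.
Qed.

(** Zorn's lemma is applied to the sets whose deletion from [A] keeps all cuts hit. *)
Lemma hits_minimal A : hits A -> exists2 B, B `<=` A & incl_minimal hits B.
Proof.
move=> hA.
have [F FP tot|X [hX maxX]] := @Zorn_bigcup _ [set X | hits (A `\` X)].
  move=> /= X cX; apply: contrapT => none.
  pose D := [set e | A e /\ leaves X e].
  have fD : finite_set D.
    by case: cX => + _ _; apply: sub_finite_set => e [_ /leaves_boundary].
  have DF : D `<=` \bigcup_(Y in F) Y.
    move=> e [Ae lXe]; apply: contrapT => nFe; apply: none; exists e => //.
  have [e Ae lXe] := hA _ cX; have [Y0 FY0 _] := DF e (conj Ae lXe).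
  have [Y FY DY] := chain_cover_finite tot FY0 fD DF.
  have [f [Af nYf] lXf] := FP _ FY _ cX.
  by apply: nYf; exact: DY.
exists (A `\` X) => [e []//|]; split=> // B BA hB.
apply/seteqP; split=> // e [Ae nXe]; apply: contrapT => nBe.
(* Deleting everything outside [B] as well would be a strictly larger admissible deletion. *)
apply: (maxX (X `|` ~` B)).
  by split=> [f|/(_ e)]; [left|move=> h; apply: nXe; apply: h; right].
move=> Y /hB[f Bf lYf]; exists f => //; have [Af nXf] := BA _ Bf.
by split=> // -[|/(_ Bf)].
Qed.

Section Minimal.
Variable A : set (edge G).
Hypothesis minA : incl_minimal hits A.

Let hitsA : hits A := minA.1.

Definition tight e X :=
  [/\ st_cut X, leaves X e &
      forall f, A f -> f <> e -> X (etail f) <-> X (ehead f)].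

(** Minimality yields a cut [X] that [e] alone leaves. If some [f] in [A] entered [X], take a cut
    [Y] that [f] alone leaves: only [e] could leave the intersection and the union of [X] and [Y],
    so [e] would leave [Y]. *)
Lemma tight_exists e : A e -> exists X, tight e X.
Proof.
have weak f : A f -> exists X, [/\ st_cut X, leaves X f &
    forall g, A g -> leaves X g -> g = f].
  move=> Af; apply: contrapT => none.
  suff : A `\ f = A by move/seteqP => [_ /(_ f Af)[_ /=]]; exact.
  apply: minA.2 => [g []//|X cX]; apply: contrapT => noneX; apply: none.
  have only g : A g -> leaves X g -> g = f.
    by move=> Ag lXg; apply: contrapT => gf; apply: noneX; exists g.
  exists X; split=> //; have [g Ag lXg] := hitsA cX.
  by rewrite -(only g).
move=> Ae; have [X [cX lXe onlyX]] := weak _ Ae; exists X; split=> // f Af fe.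
have [lXf|nlXf] := EM (leaves X f); first by case: fe; exact: onlyX.
split=> [Xt|Xh]; first by apply: contrapT => nXh; apply: nlXf.
apply: contrapT => nXt; have [Y [cY [Yt nYh] onlyY]] := weak _ Af.
have [fX sX tX] := cX; have [fY sY tY] := cY.
have [g Ag [[Xgt Ygt] /not_andP nh]] := hitsA (st_cutI cX fY sY).
have [h Ah [ht /not_orP[nXhh nYhh]]] := hitsA (st_cutU cX fY tY).
have ge : g = e.
  have [/onlyX|/onlyY gf] : leaves X g \/ leaves Y g.
    by case: nh => ?; [left|right].
  - exact.
  - by move: Xgt; rewrite gf.
have he : h = e.
  have [/onlyX|/onlyY hf] : leaves X h \/ leaves Y h.
    by case: ht => ?; [left|right].
  - exact.
  - by move: nXhh; rewrite hf.
by case: fe; apply/esym/onlyY => //; split; [rewrite -ge|rewrite -he].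
Qed.

(* Adding a component D of A that carries an edge g to the cut of g would
   produce an s-t cut that A does not leave. *)
Lemma no_isolated_part (D : set G) : fin_bd D -> side s (~` D) -> side t (~` D) ->
  (forall f, A f -> D (etail f) <-> D (ehead f)) ->
  forall g, A g -> ~ D (etail g) /\ ~ D (ehead g).
Proof.
move=> fD sD tD noX g Ag.
suff : ~ D (etail g) by have := noX g Ag; tauto.
move=> Dg; have [X [cX [Xt nXh] onlyX]] := tight_exists Ag.
have [f Af [[Xf|Df] /not_orP[nXf nDf]]] := hitsA (st_cutU cX fD tD).
- have [fg|fg] := EM (f = g); last by have := onlyX f Af fg; tauto.
  by apply: nDf; rewrite fg -noX.
- by apply: nDf; rewrite -noX.
Qed.

(** Inclusion of [X] in [Y] is asked only at endvertices of edges of [A], since elsewhere the cuts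
    are arbitrary. The arc will traverse [e] before [f]. *)
Definition precedes e X f Y :=
  [/\ Y (etail e), Y (ehead e), ~ X (etail f), ~ X (ehead f) &
      forall g, A g -> (X (etail g) -> Y (etail g)) /\ (X (ehead g) -> Y (ehead g))].

Lemma tight_compare e X f Y : A e -> A f -> e <> f -> tight e X -> tight f Y ->
  precedes e X f Y \/ precedes f Y e X.
Proof.
have nested e1 X1 e2 X2 : A e1 -> A e2 -> e1 <> e2 -> tight e1 X1 -> tight e2 X2 ->
    X2 (etail e1) -> ~ X1 (etail e2) -> precedes e1 X1 e2 X2.
  move=> A1 A2 e12 [[f1 s1 t1] [Xt1 nXh1] o1] [[f2 s2 t2] [Xt2 nXh2] o2] Yt nXt.
  have nX1h : ~ X1 (ehead e2) by rewrite -o1 //; apply: nesym.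
  have X2h : X2 (ehead e1) by rewrite -o2.
  (* No edge of [A] crosses [X1] minus [X2], which has [s] and [t] on its other side, so this set
     misses all of [A]: that is the nesting. *)
  have iso : forall g, A g -> ~ (X1 `&` ~` X2) (etail g) /\ ~ (X1 `&` ~` X2) (ehead g).
    apply: no_isolated_part.
    - by apply: fin_bdI => //; exact: fin_bdC.
    - by apply: side_sub s2 => v X2v [].
    - by apply: side_sub t1 => v X1v [].
    - move=> g Ag; have [->|g1] := EM (g = e1); first by rewrite /setI /setC /=; tauto.
      have [->|g2] := EM (g = e2); first by rewrite /setI /setC /=; tauto.
      by have := o1 g Ag g1; have := o2 g Ag g2; rewrite /setI /setC /=; tauto.
  split=> // g Ag; have [n1 n2] := iso g Ag; split=> H; apply: contrapT => H'.
    by apply: n1.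
  by apply: n2.
move=> Ae Af ef tX tY.
have [[fX sX tX'] [Xt nXh] oX] := tX; have [[fY sY tY'] [Yt nYh] oY] := tY.
have cX : st_cut X by []; have cY : st_cut Y by [].
(* If each cut contained the other edge, no edge of [A] would leave the union; if neither did, none
   would leave the intersection. *)
have [Ye|nYe] := EM (Y (etail e)); have [Xf|nXf] := EM (X (etail f)).
- have [g Ag [gt /not_orP[nXg nYg]]] := hitsA (st_cutU cX fY tY').
  have [ge|ge] := EM (g = e); first by move: nYg; rewrite ge -oY.
  have [gf|gf] := EM (g = f); first by move: nXg; rewrite gf -oX //; exact: nesym.
  have := oX g Ag ge; have := oY g Ag gf; rewrite /setU /= in gt; tauto.
- by left; exact: nested.
- by right; apply: nested => //; exact: nesym.
- have [g Ag [[Xg Yg] nh]] := hitsA (st_cutI cX fY sY).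
  have [ge|ge] := EM (g = e); first by move: nYe; rewrite -ge.
  have [gf|gf] := EM (g = f); first by move: nXf; rewrite -gf.
  have := oX g Ag ge; have := oY g Ag gf; rewrite /setI /= in nh; tauto.
Qed.

End Minimal.
End Hitting.

Section Ecard.
Variable T : choiceType.
Implicit Types A B : set T.

Lemma ecard_gt0 A : finite_set A -> (0 < ecard A)%N <-> A !=set0.
Proof.
move=> fA; rewrite /ecard cardfs_gt0; split=> [/fset0Pn[x]|[x Ax]].
  by rewrite in_fset_set // => /set_mem Ax; exists x.
by apply/fset0Pn; exists x; rewrite in_fset_set //; exact/mem_set.
Qed.

Lemma ecardU A B : finite_set A -> finite_set B -> A `&` B = set0 ->
  ecard (A `|` B) = (ecard A + ecard B)%N.
Proof.
move=> fA fB AB0; rewrite /ecard fset_setU // cardfsU -fset_setI // AB0.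
by rewrite fset_set0 cardfs0 subn0.
Qed.

Lemma ecard1 (x : T) : ecard [set x] = 1%N.
Proof. by rewrite /ecard fset_set1 cardfs1. Qed.

Lemma ecard_ltn A B x : finite_set B -> A `<=` B -> B x -> ~ A x ->
  (ecard A < ecard B)%N.
Proof.
move=> fB AB Bx nAx; have fA := sub_finite_set AB fB.
apply: fproper_ltn_card; rewrite fproperE; apply/andP; split.
  by apply/fsubsetP => y; rewrite !in_fset_set // !inE; exact: AB.
apply/negP => /fsubsetP/(_ x); rewrite !in_fset_set // !inE.
by move=> /(_ Bx).
Qed.

End Ecard.

(** * Balance and separation for minimal hitting sets *)

Section MinimalHitting.
Variables (R : realType) (G : digraph) (s t : fpoint R G).
Hypotheses (sVO : VOmega R G s) (tVO : VOmega R G t).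
Variable A : set (edge G).
Hypothesis minA : incl_minimal (hits s t) A.
Implicit Types (X Y Z : set G) (e f g : edge G) (p q : fpoint R G).

Let hitsA : hits s t A := minA.1.

(* Between two A-edges leaving X the arc re-enters X. *)
Lemma leaves_unique X e f : st_cut s t X ->
  (forall g, A g -> ~ (~ X (etail g) /\ X (ehead g))) ->
  A e -> A f -> leaves X e -> leaves X f -> e = f.
Proof.
move=> [fX sX tX] noback.
have key e1 f1 X1 Y1 : A e1 -> A f1 -> e1 <> f1 -> leaves X e1 -> leaves X f1 ->
    tight s t A e1 X1 -> tight s t A f1 Y1 -> precedes A e1 X1 f1 Y1 -> False.
  move=> A1 A2 ef [Xt nXh] [Xt' nXh'] [[f_ s_ t_] [Xt1 nXh1] o1].
  move=> [[f'_ s'_ t'_] [Yt1 nYh1] o2] [p1 p2 p3 p4 p5].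
  (* This cut contains the head of [e1] and misses the tail of [f1]. Any other edge of [A] leaving
     it crosses neither [X1] nor [Y1], so it would have to enter [X]. *)
  have [|g Ag [gt nh]] := hitsA (X := X1 `|` (Y1 `&` ~` X)).
    apply: st_cutU => //.
      by apply: fin_bdI => //; exact: fin_bdC.
    by apply: side_sub t'_ => v Yv [].
  have [ge|ge] := EM (g = e1).
    by subst g; apply: nh; right; split.
  have [gf|gf] := EM (g = f1).
    by subst g; case: gt => [//|[_ /(_ Xt')]].
  have := o1 g Ag ge; have := o2 g Ag gf; have := p5 g Ag; have := noback g Ag.
  rewrite /setU /setI /setC /= in gt nh.
  have := EM (X (ehead g)); tauto.
move=> Ae Af lXe lXf; apply: contrapT => ef.
have [Xe tXe] := tight_exists minA Ae.
have [Xf tXf] := tight_exists minA Af.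
have [|pfe] := tight_compare minA Ae Af ef tXe tXf; first exact: key.
by apply: (key f e Xf Xe) => //; exact: nesym.
Qed.

(** Induction on the number of edges of [A] crossing [X]. Given a backward edge [e] and its tight
    cut [Z], the edges leaving [X] are shared out between the intersection and the union with [Z];
    so are those entering [X], apart from [e]. Of the two extra units from the induction hypotheses,
    [e] absorbs one. *)
Lemma minimal_balanced X : st_cut s t X ->
  ecard (A `&` dedges X (~` X)) = (ecard (A `&` dedges (~` X) X) + 1)%N.
Proof.
have [n] := ubnP (ecard (A `&` boundary X)); elim: n => // n IH in X *.
rewrite ltnS => Xn cX; have [fX sX tX] := cX.
have fin Y : fin_bd Y -> [/\ finite_set (A `&` dedges Y (~` Y)),
    finite_set (A `&` dedges (~` Y) Y) & finite_set (A `&` boundary Y)].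
  move=> fY; split; apply: sub_finite_set fY => e [Ae]; first by left.
    by right.
  by [].
have [[e Ae [Xt Xh]]|noback] := pselect (exists2 e, A e & ~ X (etail e) /\ X (ehead e)).
  have [Z [[fZ sZ tZ] [Zt nZh] oZ]] := tight_exists minA Ae.
  have c1 : st_cut s t (X `&` Z) by exact: st_cutI.
  have c2 : st_cut s t (X `|` Z) by exact: st_cutU.
  (* Excluded middle on the position of [g], packaged for [tauto]; apart from [e] no edge of [A]
     crosses [Z]. *)
  have pt g : A g -> g = e \/ (X (etail g) \/ ~ X (etail g)) /\
      (X (ehead g) \/ ~ X (ehead g)) /\ (Z (etail g) \/ ~ Z (etail g)) /\
      (Z (etail g) <-> Z (ehead g)).
    move=> Ag; have [|ge] := EM (g = e); first by left.
    by right; do ![split=> //; try exact: EM]; rewrite oZ.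
  have be : boundary X e by apply/boundaryE; tauto.
  have lt1 : (ecard (A `&` boundary (X `&` Z)) < ecard (A `&` boundary X))%N.
    have [_ _ f3] := fin _ fX; apply: (ecard_ltn (x := e) f3) => //.
      move=> g [Ag bg]; split=> //; have [->//|] := pt g Ag.
      by move: bg; rewrite !boundaryE /setI /=; tauto.
    by move=> [_]; rewrite boundaryE /setI /=; tauto.
  have lt2 : (ecard (A `&` boundary (X `|` Z)) < ecard (A `&` boundary X))%N.
    have [_ _ f3] := fin _ fX; apply: (ecard_ltn (x := e) f3) => //.
      move=> g [Ag bg]; split=> //; have [->//|] := pt g Ag.
      by move: bg; rewrite !boundaryE /setU /=; tauto.
    by move=> [_]; rewrite boundaryE /setU /=; tauto.
  have IH1 := IH _ (leq_trans lt1 Xn) c1; have IH2 := IH _ (leq_trans lt2 Xn) c2.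
  have [f1o f1i _] := fin _ (let: And3 h _ _ := c1 in h).
  have [f2o f2i _] := fin _ (let: And3 h _ _ := c2 in h).
  have -> : A `&` dedges X (~` X) = (A `&` dedges (X `&` Z) (~` (X `&` Z))) `|`
      (A `&` dedges (X `|` Z) (~` (X `|` Z))).
    apply/seteqP; split=> g; rewrite /dedges /setI /setU /setC /=.
      by move=> [Ag ?]; have [?|] := pt g Ag; [subst g|]; tauto.
    by move=> [[Ag ?]|[Ag ?]]; (have [?|] := pt g Ag; [subst g|]); tauto.
  have -> : A `&` dedges (~` X) X = ((A `&` dedges (~` (X `&` Z)) (X `&` Z)) `|`
      (A `&` dedges (~` (X `|` Z)) (X `|` Z))) `|` [set e].
    apply/seteqP; split=> g; rewrite /dedges /setI /setU /setC /=.
      by move=> [Ag ?]; have [?|] := pt g Ag; [subst g|]; tauto.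
    by move=> [[[Ag ?]|[Ag ?]]|->]; [have [?|] := pt g Ag; [subst g|]..|]; tauto.
  rewrite !ecardU ?ecard1 ?IH1 ?IH2 //.
  - by rewrite -!addnA; congr addn; rewrite addnC -!addnA; congr addn; rewrite addnC.
  - apply/seteqP; split=> g //; rewrite /dedges /setI /setU /setC /=.
    by move=> [[Ag ?] [_ ?]]; have [?|] := pt g Ag; [subst g|]; tauto.
  - by rewrite finite_setU.
  - apply/seteqP; split=> g //; rewrite /dedges /setI /setU /setC /=.
    by move=> [[[Ag ?]|[Ag ?]] ?]; subst g; tauto.
  - apply/seteqP; split=> g //; rewrite /dedges /setI /setU /setC /=.
    by move=> [[Ag ?] [_ ?]]; have [?|] := pt g Ag; [subst g|]; tauto.
have [e Ae lXe] := hitsA cX.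
have -> : A `&` dedges (~` X) X = set0.
  by apply/seteqP; split=> g // [Ag] [? ?]; apply: noback; exists g.
have -> : A `&` dedges X (~` X) = [set e].
  apply/seteqP; split=> [g [Ag lXg]|g ->] //=.
  by apply: (leaves_unique cX) => // h Ah bh; apply: noback; exists h.
by rewrite ecard1 /ecard fset_set0 cardfs0.
Qed.

(** For vertices and ends, the combinatorial form of lying in the closure of [A]; see
    [eclosure_adherent] and [adherent_eclosure]. *)
Definition adherent p :=
  VOmega R G p /\ forall D, fin_bd D -> side p D ->
    exists2 g, A g & D (etail g) \/ D (ehead g).

Variable cut_of : edge G -> set G.
Hypothesis cut_ofP : forall e, A e -> tight s t A e (cut_of e).

(* A cut Z separating p from q with fewest A-edges crosses none: an A-edge e in
   Z could be dropped by intersecting with the side of cut_of e containing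
   p and q. *)
Lemma tight_separation p q : adherent p -> adherent q -> p <> q ->
  locally_finite G ->
  exists2 e, A e & ~ (side p (cut_of e) <-> side q (cut_of e)).
Proof.
move=> ap aq pq lf; apply: contrapT => none.
have same e : A e -> side p (cut_of e) <-> side q (cut_of e).
  by move=> Ae; apply: contrapT => ne; apply: none; exists e.
have [Z [fZ pZ qZ]] := side_separation lf ap.1 aq.1 pq.
(* The induction ranges over [p] and [q] too, because shrinking the cut may exchange their roles. *)
have [n] := ubnP (ecard (A `&` boundary Z)).
move: fZ pZ qZ ap aq same; clear pq none; elim: n p q Z => // n IH p q Z.
move=> fZ pZ qZ ap aq same; rewrite ltnS => Zn.
have fZC := fin_bdC fZ.
(* Suppose no edge of [A] crosses [Z]. With [s] and [t] on one side, the other side is isolated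
   although [p] or [q] is adherent there; with [s] and [t] on different sides, [hits] fails. *)
have [[e [Ae be]]|nob] := pselect (A `&` boundary Z !=set0); last first.
  have noZ f : A f -> Z (etail f) <-> Z (ehead f).
    move=> Af; apply: contrapT => /boundaryE bf; apply: nob.
    by exists f.
  have [sZ|sZ] := side_total sVO fZ; have [tZ|tZ] := side_total tVO fZ.
  - have [g Ag] := aq.2 _ fZC qZ; have [] := no_isolated_part minA fZC _ _ _ Ag.
    + by rewrite setCK.
    + by rewrite setCK.
    + by move=> f Af; have := noZ f Af; rewrite /setC /=; tauto.
    + by rewrite /setC /=; tauto.
  - have [g Ag [? ?]] : exists2 e, A e & leaves Z e by apply: hitsA.
    by have := noZ g Ag; tauto.
  - have [|g Ag] := hitsA (X := ~` Z); first by split; rewrite ?setCK.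
    by rewrite /leaves /setC /=; have := noZ g Ag; have := EM (Z (ehead g)); tauto.
  - have [g Ag] := ap.2 _ fZ pZ.
    by have [] := no_isolated_part minA fZ sZ tZ noZ Ag; tauto.
have [U [fU pU qU oU]] : exists U, [/\ fin_bd U, side p U, side q U &
    ~ (U (etail e) <-> U (ehead e)) /\
    forall f, A f -> f <> e -> U (etail f) <-> U (ehead f)].
  have [[fX _ _] [Xt nXh] oX] := cut_ofP Ae.
  have [pX|pX] := side_total ap.1 fX.
    exists (cut_of e); split=> //; first by rewrite -same.
    by split=> //; tauto.
  exists (~` cut_of e); split=> //.
  - exact: fin_bdC.
  - have [|//] := side_total aq.1 fX.
    by rewrite -same // => pX'; case: (side_excl fX pX' pX).
  - split=> [|f Af fe]; rewrite /setC /=; first tauto.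
    by have := oX f Af fe; tauto.
have [fin1 ne] : finite_set (A `&` boundary Z) /\ ~ (Z (etail e) <-> Z (ehead e)).
  by split; [exact: sub_finite_set fZ => ? []|exact/boundaryE].
have EZ g : (U (etail g) \/ ~ U (etail g)) /\ (U (ehead g) \/ ~ U (ehead g)) /\
    (Z (etail g) \/ ~ Z (etail g)) /\ (Z (ehead g) \/ ~ Z (ehead g)).
  by do ![split=> //; try exact: EM].
(* Since [e] crosses both [U] and [Z], either the intersection of [U] and [Z] or [U] minus [Z]
   contains no endvertex of [e]. That part still separates [p] from [q] and is crossed by fewer
   edges of [A]. *)
have [inZ|ninZ] := EM (U (etail e) /\ Z (etail e) \/ U (ehead e) /\ Z (ehead e)).
  apply: (IH q p (U `&` ~` Z)) => //.
  - exact: fin_bdI.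
  - exact: sideI.
  - by apply: side_sub pZ => v Zv [].
  - by move=> f Af; have := same f Af; tauto.
  apply: leq_trans Zn; apply: (ecard_ltn (x := e)) => //.
    move=> g [Ag]; rewrite boundaryE => bg; split=> //; apply/boundaryE.
    move: bg; rewrite /setI /setC /=; have [->//|ge] := EM (g = e).
    by have := oU.2 g Ag ge; have := EZ g; tauto.
  move=> [_]; rewrite boundaryE /setI /setC /=; have := EZ e; have := oU.1; tauto.
apply: (IH p q (U `&` Z)) => //.
- exact: fin_bdI.
- exact: sideI.
- by apply: side_sub qZ => v Zv [].
apply: leq_trans Zn; apply: (ecard_ltn (x := e)) => //.
  move=> g [Ag]; rewrite boundaryE => bg; split=> //; apply/boundaryE.
  move: bg; rewrite /setI /setC /=; have [->//|ge] := EM (g = e).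
  by have := oU.2 g Ag ge; have := EZ g; tauto.
move=> [_]; rewrite boundaryE /setI /setC /=; have := EZ e; have := oU.1; tauto.
Qed.

End MinimalHitting.

(** * Cut functions on the Freudenthal compactification *)

Section CutFunction.
Variables (R : realType) (G : digraph).
Implicit Types (p q : fpoint R G) (X Y S C : set G) (e f : edge G).

Lemma nbhs_basic p U : nbhs p U -> exists2 B, basic_nbhd p B & B `<=` U.
Proof.
rewrite nbhsE => -[O [oO Op] OU]; have [B pB BO] := (oO : fopen O) p Op.
by exists B => //; exact: subset_trans OU.
Qed.

Lemma basic_continuous (f : fpoint R G -> R) :
  (forall p (eps : R), 0 < eps ->
    exists2 B, basic_nbhd p B & forall q, B q -> `|f p - f q| < eps) ->
  continuous f.
Proof.
move=> fB; apply/continuousP => O oO; suff : fopen (f @^-1` O) by [].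
move=> p /= Op; have : nbhs (f p) O by exact: open_nbhs_nbhs.
move=> /nbhs_ballP[eps eps0 epsO]; have [B pB Bf] := fB p eps eps0.
by exists B => // q /Bf ?; exact: epsO.
Qed.

Lemma inner_ball_nbhs e (x : {x : R | 0 < x < 1}) (d : R) : 0 < d ->
  nbhs (Inner e x : fpoint R G) (edge_ball e (val x) d).
Proof.
move=> d0; apply: open_nbhs_nbhs; split; last by rewrite /= subrr normr0.
suff : fopen (edge_ball e (val x) d : set (fpoint R G)) by [].
move=> [v|f y|w] //= [-> yx]; exists (edge_ball e (val y) (d - `|val y - val x|)).
  by exists (d - `|val y - val x|) => //; rewrite subr_gt0.
move=> [v|f' z|w] //= [-> zy]; split=> //.
rewrite (le_lt_trans (ler_distD (val y) _ _)) //.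
by rewrite -ltrBrDr.
Qed.

Lemma edge_pt_inner e (x : R) (x01 : 0 < x < 1) :
  edge_pt e x = Inner e (exist _ x x01).
Proof. by rewrite /edge_pt insubT. Qed.

Lemma edge_pt_val e (x : {x : R | 0 < x < 1}) : edge_pt e (val x) = Inner e x.
Proof. by rewrite /edge_pt valK. Qed.

Lemma edge_pt_le0 e (x : R) : x <= 0 -> edge_pt e x = Vertex (etail e).
Proof. by move=> x0; rewrite /edge_pt x0 insubF // ltNge x0. Qed.

Lemma edge_pt_ge1 e (x : R) : 1 <= x -> edge_pt e x = Vertex (ehead e).
Proof.
move=> x1; rewrite /edge_pt leNgt (lt_le_trans ltr01 x1) insubF //.
by rewrite [x < 1]ltNge x1 andbF.
Qed.

Definition off X (v : G) : R := (`[< ~ X v >])%:R.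

Definition cutfun X p : R :=
  match p with
  | Vertex v => off X v
  | Inner e x => (1 - val x) * off X (etail e) + val x * off X (ehead e)
  | End w => (`[< ~ end_in w X >])%:R
  end.

Lemma off0 X v : X v -> off X v = 0.
Proof. by move=> Xv; rewrite /off asboolF //; exact. Qed.

Lemma off1 X v : ~ X v -> off X v = 1.
Proof. by move=> Xv; rewrite /off asboolT. Qed.

Lemma offP X v : X v /\ off X v = 0 \/ ~ X v /\ off X v = 1.
Proof. by have [Xv|Xv] := EM (X v); [left; rewrite off0|right; rewrite off1]. Qed.

Lemma cutfun_itv X p : 0 <= cutfun X p <= 1.
Proof.
case: p => [v|e [x /= x01]|w] /=.
- by case: (offP X v) => -[_ ->]; lra.
- by case: (offP X (etail e)) => -[_ ->]; case: (offP X (ehead e)) => -[_ ->]; lra.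
- by case: `[< _ >]; rewrite ?lexx ?ler01 ?lexx.
Qed.

Lemma cutfun_edge_pt X e (x : R) : 0 <= x <= 1 ->
  cutfun X (edge_pt e x) = (1 - x) * off X (etail e) + x * off X (ehead e).
Proof.
move=> /andP[]; rewrite le_eqVlt => /orP[/eqP<- _|x0].
  by rewrite edge_pt_le0 //=; lra.
rewrite le_eqVlt => /orP[/eqP->|x1]; first by rewrite edge_pt_ge1 //=; lra.
by rewrite edge_pt_inner ?x0 ?x1.
Qed.

Lemma cutfun_side X p : side p X -> cutfun X p = 0.
Proof.
by case: p => [v|//|w] /= h; [exact: off0|rewrite asboolF //; exact].
Qed.

Lemma cutfun_sideC X p : fin_bd X -> side p (~` X) -> cutfun X p = 1.
Proof.
move=> fX; case: p => [v|//|w] /= h; first exact: off1.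
by rewrite asboolT // => wX; case: (end_in_excl fX wX).
Qed.

(** On edges the slope is at most 1 in absolute value. Near an end, deleting the endvertices of the
    boundary edges leaves a component on one side of [X], so the function is constant there. *)
Lemma cutfun_continuous X : fin_bd X -> continuous (cutfun X).
Proof.
move=> fX; apply: basic_continuous => -[v|e x|w] eps eps0.
- exists (star v (Num.min 1 eps)).
    by exists (Num.min 1 eps) => //; rewrite lt_min ltr01 eps0 ge_min lexx.
  move=> [u|f [y /= /andP[y0 y1]]|w] //=; first by move=> ->; rewrite subrr normr0.
  move=> [[<-]|[<-]]; rewrite ?ltrBlDr -?ltrBlDl lt_min => /andP[_ ylt];
    rewrite ltr_norml;
    by case: (offP X (etail f)) => -[_ ->]; case: (offP X (ehead f)) => -[_ ->]; lra.
- exists (edge_ball e (val x) eps); first by exists eps.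
  case: x => x /= x01; move=> [u|f [y /= /andP[y0 y1]]|w] //= [->]; rewrite !ltr_norml.
  by case: (offP X (etail e)) => -[_ ->]; case: (offP X (ehead e)) => -[_ ->]; lra.
have [r wr] := gend_inhab w; have fS := bd_ends_finite fX.
have [k kS] := ray_avoid r fS.
pose C := [set v | connected_off (bd_ends X) (ray_vertex r k) v].
have wC : end_in w C.
  by apply: end_in_tail wr _ => n; exact: (ray_connected kS).
exists (end_nbhd (bd_ends X) C 1).
  exists (bd_ends X), C, 1; split=> //; last by rewrite ltr01 lexx.
  by exists (ray_vertex r k) => //; rewrite -[k]addn0.
pose a : R := off X (ray_vertex r k).
have CX v : C v -> off X v = a.
  move=> cv; have kv := connected_off_bd (@subset_refl _ (bd_ends X)) cv; rewrite /a.
  case: (offP X v) => -[? ->]; case: (offP X (ray_vertex r k)) => -[? ->] //; tauto.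
have CS v : C v -> ~ bd_ends X v by move=> cv; case: (connected_offP cv).
have bdX f : off X (etail f) <> off X (ehead f) -> boundary X f.
  move=> ne; apply/boundaryE => E; apply: ne.
  by case: (offP X (etail f)) => -[? ->]; case: (offP X (ehead f)) => -[? ->] //; tauto.
have Cf f : C (etail f) \/ C (ehead f) -> off X (etail f) = a /\ off X (ehead f) = a.
  move=> Cth; have /contrapT E : ~ off X (etail f) <> off X (ehead f).
    move=> /bdX bf; case: Cth => /CS; apply; first by left; exists f.
    by right; exists f.
  by case: Cth => /CX; [rewrite -E|rewrite E].
have aw w' : end_in w' C -> cutfun X (End w') = a.
  move=> [r' w'r' r'C]; have [Xk|Xk] := EM (X (ray_vertex r k)).
    rewrite /a off0 // cutfun_side //; exists r' => // n.
    by rewrite -(connected_off_bd (@subset_refl _ (bd_ends X)) (r'C n)).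
  rewrite /a off1 // cutfun_sideC //; exists r' => // n.
  by rewrite /setC /= -(connected_off_bd (@subset_refl _ (bd_ends X)) (r'C n)).
rewrite (aw w wC) => -[u /CX /= ->|f y|w' /aw ->]; rewrite ?subrr ?normr0 //=.
move=> fC; have [-> ->] : off X (etail f) = a /\ off X (ehead f) = a.
  by apply: Cf; case: fC => [[]|[]|[]]; tauto.
by rewrite -mulrDl subrK mul1r subrr normr0.
Qed.

(** The level set is closed, so identities on the closure of [A] need only be checked along single
    edges. *)
Lemma eclosure_const A (h : fpoint R G -> R) (c : R) : continuous h ->
  (forall e (x : R), A e -> 0 <= x <= 1 -> h (edge_pt e x) = c) ->
  forall p, eclosure R A p -> h p = c.
Proof.
move=> hc h0 p Ap; suff : (h @^-1` [set c]) p by [].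
have : closed (h @^-1` [set c]).
  by apply: closed_comp => [? _|]; [exact: hc|exact: closed_eq].
move=> /closure_id ->; apply: closure_subset Ap => _ [e Ae [x /= + <-]].
by rewrite in_itv /= => x01; exact: h0.
Qed.

Lemma edge_pt_eclosure A e (x : R) : A e -> 0 <= x <= 1 ->
  eclosure R A (edge_pt e x).
Proof.
by move=> Ae x01; apply: subset_closure; exists e => //; exists x => //=; rewrite in_itv.
Qed.

Lemma edge_pt_eq e f (x y : R) : 0 < y < 1 ->
  edge_pt e x = edge_pt f y -> e = f /\ x = y.
Proof.
move=> y01; rewrite (edge_pt_inner f y01) /edge_pt.
by case: insubP => [z _ <- [-> ->]//|_ //].
Qed.

(** A ball around an inner point contains only points of the same edge. *)
Lemma inner_eclosure A e x : eclosure R A (Inner e x) -> A e.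
Proof.
move=> /(_ _ (inner_ball_nbhs e x ltr01))[q [[f Af [y _ <-]]]] /=.
by rewrite /edge_pt; case: insubP => //= z _ _ [<-].
Qed.

(** If no edge of [A] touched [D], the cut function of [D] would be 1 on the closure of [A], but it
    is 0 at [p]. *)
Lemma eclosure_adherent A p : VOmega R G p -> eclosure R A p -> adherent A p.
Proof.
move=> pVO Ap; split=> // D fD pD; apply: contrapT => none.
suff : cutfun D p = 1 by rewrite cutfun_side //; lra.
apply: (eclosure_const (cutfun_continuous fD) _ Ap) => e x Ae x01.
rewrite cutfun_edge_pt // !off1; first by lra.
  by move=> Dh; apply: none; exists e => //; right.
by move=> Dt; apply: none; exists e => //; left.
Qed.

(** Adherence is applied to the singleton of a vertex, or to the component defining a neighbourhood
    of an end. On the edge found, the point at distance [eps / 2] from its endvertex there lies in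
    the neighbourhood. *)
Lemma adherent_eclosure A p : locally_finite G -> adherent A p -> eclosure R A p.
Proof.
move=> lf [pVO pA] U /nbhs_basic[B pB BU].
suff [e [x [Ae x01 Bx]]] : exists e x, [/\ A e, 0 <= x <= 1 & B (edge_pt e x)].
  exists (edge_pt e x); split; last exact: BU.
  by exists e => //; exists x => //=; rewrite in_itv.
have half (eps : R) : 0 < eps <= 1 -> 0 < eps / 2 < 1 /\ 0 < 1 - eps / 2 < 1 by lra.
case: p pVO pA pB => [v _|e x [[]//|[]//]|w _] pA.
  move=> [eps eps01 ->]; have [h1 h2] := half _ eps01.
  have [e Ae [te|he]] := pA _ (fin_bd_finite lf (finite_set1 v)) erefl.
    exists e, (eps / 2); split=> //; first by lra.
    by rewrite (edge_pt_inner e h1) /=; left; split=> //; lra.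
  exists e, (1 - eps / 2); split=> //; first by lra.
  by rewrite (edge_pt_inner e h2) /=; right; split=> //; lra.
move=> [S [C [eps [fS cC wC eps01 ->]]]]; have [h1 h2] := half _ eps01.
have [e Ae [te|he]] := pA _ (fin_bd_component lf fS cC) wC.
  exists e, (eps / 2); split=> //; first by lra.
  rewrite (edge_pt_inner e h1) /=; have [Se|Se] := EM (S (ehead e)).
    by apply: Or32; split=> //; lra.
  by apply: Or31; split=> //; apply: (is_component_joins cC _ te Se); left.
exists e, (1 - eps / 2); split=> //; first by lra.
rewrite (edge_pt_inner e h2) /=; have [Se|Se] := EM (S (etail e)).
  by apply: Or33; split=> //; lra.
by apply: Or31; split=> //; apply: (is_component_joins cC _ he Se); right.
Qed.

(** The cut function vanishes on the closure of [X] and is 1 on the other side. Conversely, a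
    neighbourhood of an end contains a ray of it, which has a tail in [X]. *)
Lemma vclosureE X p : VOmega R G p -> fin_bd X -> vclosure R X p <-> side p X.
Proof.
move=> pVO fX; split=> [pX|pX].
  have [//|/(cutfun_sideC fX)] := side_total pVO fX.
  suff -> : cutfun X p = 0 by lra.
  suff : (cutfun X @^-1` [set 0]) p by [].
  have : closed (cutfun X @^-1` [set 0]).
    apply: closed_comp => [? _|]; last exact: closed_eq.
    exact: cutfun_continuous.
  move=> /closure_id ->; apply: closure_subset pX => _ [v Xv <-].
  exact: cutfun_side.
move=> U /nbhs_basic[B pB BU].
suff [v Xv Bv] : exists2 v, X v & B (Vertex v).
  by exists (Vertex v); split; [exists v|exact: BU].
case: p pVO pX pB => [v _|//|w _] /= wX; first by move=> [eps _ ->]; exists v.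
move=> [S [C [eps [fS cC [r wr rC] eps01 ->]]]].
have [k rX] := end_in_ray fX wX wr.
by exists (ray_vertex r (k + 0)) => //=; exact: rC.
Qed.

End CutFunction.

(** * Compactness *)

Lemma ultra_finite (T : Type) (U : choiceType) (F : set_system T)
    (f : T -> U) (D : set U) : UltraFilter F -> finite_set D ->
  F [set x | D (f x)] -> exists2 v, D v & F [set x | f x = v].
Proof.
move=> UF /finite_seqP[l ->]; elim: l => [|u l IH] Fl.
  by have [x] := filter_ex Fl.
have [Fu|Fu] := in_ultra_setVsetC [set x | f x = u] UF.
  by exists u => //; rewrite /= mem_head.
have [|v lv Fv] := IH; last by exists v => //; rewrite /= in_cons; apply/orP; right.
apply: filterS (filterI Fl Fu) => x [/=].
by rewrite in_cons => /orP[/eqP|].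
Qed.

Section BreadthFirst.
Variable G : digraph.
Hypotheses (lf : locally_finite G) (wc : weakly_connected G).
Variable o : G.

Fixpoint bfs_ball (n : nat) : set G :=
  if n is n.+1 then
    bfs_ball n `|` [set v | exists u e, bfs_ball n u /\ joins e u v]
  else [set o].

Lemma bfs_ball_finite n : finite_set (bfs_ball n).
Proof.
elim: n => [|n IH] /=; first exact: finite_set1.
rewrite finite_setU; split=> //.
pose E := \bigcup_(u in bfs_ball n) [set e | etail e = u \/ ehead e = u].
have fE : finite_set E by apply: bigcup_finite => // u _; exact: lf.
have fV : finite_set (@etail G @` E `|` @ehead G @` E).
  by rewrite finite_setU; split; exact: finite_image.
apply: sub_finite_set fV => v [u [e [bu j]]].
by case: j => -[eu ev]; [right|left]; exists e => //; exists u => //=;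
  [left|right].
Qed.

Lemma bfs_ball_cover v : exists n, `[< bfs_ball n v >].
Proof.
elim: (wc o v) => [_|x y e _ [n /asboolP nx] j _]; first by exists 0%N; apply/asboolP.
by exists n.+1; apply/asboolP; right; exists x, e.
Qed.

Definition level v : nat := ex_minn (bfs_ball_cover v).

Lemma bfs_ball_mono m n : (m <= n)%N -> bfs_ball m `<=` bfs_ball n.
Proof.
elim: n => [|n IH]; first by rewrite leqn0 => /eqP->.
by rewrite leq_eqVlt => /orP[/eqP->//|/IH mn v /mn]; left.
Qed.

Lemma bfs_ballE n v : bfs_ball n v <-> (level v <= n)%N.
Proof.
rewrite /level; case: ex_minnP => m /asboolP bm minm; split=> [nv|mn].
  by apply: minm; apply/asboolP.
exact: bfs_ball_mono bm.
Qed.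

Lemma finite_sub_bfs_ball S : finite_set S -> exists n, S `<=` bfs_ball n.
Proof.
move=> /finite_seqP[l ->]; elim: l => [|v l [n IH]]; first by exists 0%N.
exists (maxn n (level v)) => u; rewrite /= in_cons => /orP[/eqP->|/IH].
  by rewrite bfs_ballE leq_maxr.
by rewrite !bfs_ballE => un; rewrite leq_max un.
Qed.

Lemma parent_exists : exists f : G -> G, forall v, (0 < level v)%N ->
  (level (f v)).+1 = level v /\ exists e, joins e (f v) v.
Proof.
suff /choice[f fP] : forall v, exists u, (0 < level v)%N ->
  (level u).+1 = level v /\ exists e, joins e u v by exists f.
move=> v; have [v0|v0] := boolP (0 < level v)%N; last by exists v.
have : bfs_ball (level v).-1.+1 v by rewrite bfs_ballE prednK.
move=> /= [|[u [e [bu j]]]].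
  by rewrite bfs_ballE -ltnS prednK // ltnn.
exists u => _; split; last by exists e.
apply/eqP; rewrite eqn_leq; apply/andP; split.
  by move: bu; rewrite bfs_ballE -ltnS prednK.
have : bfs_ball (level u).+1 v by right; exists u, e; rewrite bfs_ballE.
by rewrite bfs_ballE.
Qed.

Definition parent : G -> G := projT1 (cid parent_exists).

Lemma parentP v : (0 < level v)%N ->
  (level (parent v)).+1 = level v /\ exists e, joins e (parent v) v.
Proof. exact: (projT2 (cid parent_exists)). Qed.

(** For [k] beyond the level of [v], truncated subtraction makes this [v] itself. *)
Definition ancestor k v := iter (level v - k) parent v.

Lemma iter_parent n j v : (j + n < level v)%N ->
  level (iter j parent v) = (level v - j)%N /\
  connected_off (bfs_ball n) (iter j parent v) v.
Proof.
elim: j => [|j IH] jn /=.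
  by rewrite subn0; split=> //; apply: connected_off_refl; rewrite bfs_ballE leqNgt jn.
have [lj cj] := IH (ltnW jn).
have [] := parentP (v := iter j parent v).
  by rewrite lj subn_gt0; apply: leq_ltn_trans jn; rewrite addSn ltnW // ltnS leq_addr.
rewrite lj => lp [e je]; have lp' : level (parent (iter j parent v)) = (level v - j.+1)%N.
  by rewrite subnS -lp.
split=> //; apply: connected_off_trans cj.
apply/connected_off_sym; apply: connected_off_step (joinsC je) _.
  apply: connected_off_refl; rewrite bfs_ballE lj leqNgt ltn_subRL.
  by rewrite ltnW.
by rewrite bfs_ballE lp' leqNgt ltn_subRL jn.
Qed.

Lemma ancestor_level k v : (k <= level v)%N -> level (ancestor k v) = k.
Proof.
have root n : forall u, level u = n -> level (iter n parent u) = 0%N.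
  elim: n => // n IH u un; rewrite iterSr IH //.
  by have := parentP (v := u); rewrite un => /(_ isT)[[]].
case: k => [|k] kv; rewrite /ancestor; first by rewrite subn0 root.
have [|-> _] := @iter_parent k (level v - k.+1) v; last by rewrite subKn.
by rewrite -addnS subnK.
Qed.

Lemma ancestor_parent k v : (k < level v)%N ->
  parent (ancestor k.+1 v) = ancestor k v.
Proof. by move=> kv; rewrite /ancestor -iterS -subSn // subSS. Qed.

Lemma ancestor_connected n k v : (n < k)%N -> (k <= level v)%N ->
  connected_off (bfs_ball n) (ancestor k v) v.
Proof.
move=> nk kv; have [|//] := @iter_parent n (level v - k) v.
by rewrite -{2}(subnK kv) ltn_add2l.
Qed.

Definition tree_ray (r : ray G) :=
  forall k, level (ray_vertex r k) = k /\
    parent (ray_vertex r k.+1) = ray_vertex r k.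

Lemma tree_ray_avoid r n k : tree_ray r -> (n < k)%N ->
  forall j, ~ bfs_ball n (ray_vertex r (k + j)).
Proof.
by move=> tr nk j; rewrite bfs_ballE (tr _).1 leqNgt (leq_trans nk) ?leq_addr.
Qed.

(** Koenig's lemma by ultrafilter: levels are finite, so the ultrafilter settles on one vertex at
    each level, and consecutive choices are adjacent in the tree. *)
Lemma ultra_tree_ray (T : Type) (F : set_system T) (a : nat -> T -> G) :
  UltraFilter F ->
  (forall k, F [set x | level (a k x) = k /\ parent (a k.+1 x) = a k x]) ->
  exists2 r, tree_ray r & forall k, F [set x | a k x = ray_vertex r k].
Proof.
move=> UF Fa; have /choice[v vP] : forall k, exists v, F [set x | a k x = v].
  move=> k; have [|v _] := ultra_finite (f := a k) UF (bfs_ball_finite k).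
    by apply: filterS (Fa k) => x [kx _]; rewrite /= bfs_ballE kx.
  by exists v.
have vT k : level (v k) = k /\ parent (v k.+1) = v k.
  have [x [[/= <- <-] //]] := filter_ex (filterI (filterI (vP k) (vP k.+1)) (Fa k)).
have vj k : exists e, joins e (v k) (v k.+1).
  have [|_] := parentP (v := v k.+1); first by rewrite (vT _).1.
  by rewrite (vT k).2.
have [e eP] := choice vj.
have vI : injective v by move=> i j ij; rewrite -(vT i).1 ij (vT j).1.
by exists (Ray vI eP) => // k; exact: vT.
Qed.

(** The ancestors of ever farther vertices of [r0] converge to a tree ray. Outside a ball containing
    [S], an ancestor stays linked to its descendant on [r0]. *)
Lemma ray_tree_ray (r0 : ray G) : exists2 r, tree_ray r & ray_equiv r0 r.
Proof.
have [F [UF oF]] := ultraFilterLemma (@eventually_filter).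
have far k : F [set n | (k < level (ray_vertex r0 n))%N].
  apply: oF; have [j jk] := ray_avoid r0 (bfs_ball_finite k).
  exists j => // n /= jn; rewrite ltnNge; apply/negP; rewrite -bfs_ballE.
  by rewrite -(subnKC jn); exact: jk.
have [k|r tr rF] := @ultra_tree_ray _ F (fun k n => ancestor k (ray_vertex r0 n)) UF.
  apply: filterS (far k) => n /= kn.
  by rewrite ancestor_level ?ancestor_parent // ltnW.
exists r => // S /finite_sub_bfs_ball[n Sn].
have [m [/= rm nm]] := filter_ex (filterI (rF n.+1) (far n)).
exists m, n.+1; rewrite -rm; apply: (connected_off_sub Sn).
by apply/connected_off_sym; apply: ancestor_connected.
Qed.

Lemma end_tree_ray : exists f : gend G -> ray G,
  forall w, sval w (f w) /\ tree_ray (f w).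
Proof.
suff /choice[f fP] : forall w : gend G, exists r, sval w r /\ tree_ray r by exists f.
move=> w; have [r0 wr0] := gend_inhab w; have [r tr r0r] := ray_tree_ray r0.
by exists r; split=> //; rewrite (gend_equiv _ wr0).
Qed.

Lemma edge_countable : countable [set: edge G].
Proof.
pose E n := \bigcup_(u in bfs_ball n) [set e | etail e = u \/ ehead e = u].
have -> : [set: edge G] = \bigcup_n E n.
  apply/seteqP; split=> // e _; exists (level (etail e)) => //.
  by exists (etail e) => //=; [rewrite bfs_ballE|left].
apply: bigcup_countable => // n _; apply: finite_set_countable.
by apply: bigcup_finite; [exact: bfs_ball_finite|move=> u _; exact: lf].
Qed.

Variable R : realType.

Lemma edge_pt_continuous (e : edge G) : continuous (@edge_pt R G e).
Proof.
move=> x U /nbhs_basic[B + BU].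
suff key : exists2 d : R, 0 < d & basic_nbhd (edge_pt e x) B ->
    forall y, `|x - y| < d -> B (edge_pt e y).
  have [d d0 dB] := key => /dB {}dB.
  by apply/nbhs_ballP; exists d => // y /= xy; exact/BU/dB.
have [x0|x0] := leP x 0.
  rewrite (edge_pt_le0 _ x0).
  have [[d d01 ->]|nB] := pselect (basic_nbhd (Vertex (etail e) : fpoint R G) B);
    last by exists 1.
  exists d => [|_ y]; first by case/andP: d01.
  rewrite ltr_norml => xyd; have [y0|y0] := leP y 0.
    by rewrite edge_pt_le0.
  have y01 : 0 < y < 1 by lra.
  by rewrite edge_pt_inner /=; left; split=> //; lra.
have [x1|x1] := leP 1 x.
  rewrite (edge_pt_ge1 _ x1).
  have [[d d01 ->]|nB] := pselect (basic_nbhd (Vertex (ehead e) : fpoint R G) B);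
    last by exists 1.
  exists d => [|_ y]; first by case/andP: d01.
  rewrite ltr_norml => xyd; have [y1|y1] := leP 1 y.
    by rewrite edge_pt_ge1.
  have y01 : 0 < y < 1 by lra.
  by rewrite edge_pt_inner /=; right; split=> //; lra.
have x01 : 0 < x < 1 by rewrite x0.
rewrite (edge_pt_inner e x01).
have [[d d0 ->]|nB] := pselect (basic_nbhd (Inner e (exist _ x x01) : fpoint R G) B);
    last by exists 1.
exists (Num.min d (Num.min x (1 - x))) => [|_ y].
  by rewrite !lt_min d0 x0 subr_gt0.
rewrite !lt_min !ltr_norml => /and3P[xyd xy1 xy2].
have y01 : 0 < y < 1 by lra.
by rewrite edge_pt_inner /=; split=> //; rewrite ltr_norml; lra.
Qed.

Lemma edge_pt_compact (e : edge G) : compact (@edge_pt R G e @` `[0, 1]).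
Proof.
apply: continuous_compact; last exact: segment_compact.
by apply: continuous_subspaceT; exact: edge_pt_continuous.
Qed.

(** An ultrafilter either concentrates on boundedly many levels, where finitely many vertices and
    edges form a compact set, or leaves every ball. In the latter case the ancestors of its points
    trace a tree ray, whose end is a limit. *)
Lemma fpoint_compact : compact [set: fpoint R G].
Proof.
rewrite compact_ultra => F UF _.
pose deep n (p : fpoint R G) := match p with
  | Vertex v => (n < level v)%N
  | Inner e _ => (n < level (etail e))%N
  | End _ => true end.
have [[n Fn]|nF] := pselect (exists n, F [set p | ~ deep n p]).
  pose K := (@Vertex R G @` bfs_ball n) `|`
    \bigcup_(e in \bigcup_(u in bfs_ball n) [set e | etail e = u \/ ehead e = u])
      edge_pt e @` `[0, 1].
  have cK : compact K.
    apply: compactU; first by apply/finite_compact/finite_image/bfs_ball_finite.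
    have /finite_seqP[l ->] : finite_set
        (\bigcup_(u in bfs_ball n) [set e : edge G | etail e = u \/ ehead e = u]).
      by apply: bigcup_finite; [exact: bfs_ball_finite|move=> u _; exact: lf].
    by rewrite bigcup_seq; apply: bigsetU_compact => e _; exact: edge_pt_compact.
  have FK : F K.
    apply: filterS Fn => -[v|e x|w] //= /negP; rewrite -leqNgt -bfs_ballE => bn.
      by left; exists v.
    right; exists e; first by exists (etail e) => //; left.
    exists (val x); last by rewrite edge_pt_val.
    by case: x => x /= /andP[? ?]; rewrite in_itv /= !ltW.
  by move: cK; rewrite compact_ultra => /(_ F UF FK)[p [_ Fp]]; exists p.
have Fdeep k : F [set p | deep k p].
  have [//|Fk] := in_ultra_setVsetC [set p | deep k p] UF.
  by case: nF; exists k.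
have [tr trP] := end_tree_ray.
pose a k (p : fpoint R G) := match p with
  | Vertex v => ancestor k v
  | Inner e _ => ancestor k (etail e)
  | End w => ray_vertex (tr w) k end.
have [k|r rT rF] := ultra_tree_ray (a := a) UF.
  apply: filterS (Fdeep k) => -[v|e x|w] /= kp.
  - by rewrite ancestor_level ?ancestor_parent // ltnW.
  - by rewrite ancestor_level ?ancestor_parent // ltnW.
  - exact: (trP w).2.
exists (End (ray_end r)); split=> // U /nbhs_basic[_ [S [C [eps [fS cC wC eps01 ->]]]] BU].
apply: filterS BU _; have [n Sn] := finite_sub_bfs_ball fS.
(* At this depth not only the tail of an edge but also its head lies outside the ball containing
   [S]. *)
apply: filterS (filterI (rF n.+2) (Fdeep n.+2)).
have conC u v : connected_off (bfs_ball n) u v -> C u -> C v.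
  move=> /(connected_off_sub Sn) uv; case: cC => x _ -> /= xu.
  exact: connected_off_trans uv.
have rC : C (ray_vertex r n.+2).
  have fC := fin_bd_component lf fS cC.
  have [k kC] := end_in_ray fC wC (ray_equiv_refl r).
  apply: conC (kC n.+2); apply/connected_off_sym; rewrite addnC.
  by apply: ray_connected; apply: tree_ray_avoid.
move=> [v|e x|w] /= [vr kv].
- apply: conC rC; rewrite -vr; apply: ancestor_connected => //.
  exact: ltnW.
- have Ct : C (etail e).
    by apply: conC rC; rewrite -vr; apply: ancestor_connected => //; exact: ltnW.
  apply: Or31; split=> //; apply: (is_component_joins (e := e) cC _ Ct); first by left.
  move=> /Sn be; have : bfs_ball n.+1 (etail e).
    by right; exists (ehead e), e; split=> //; right.
  by rewrite bfs_ballE leqNgt; case/negP; exact: ltnW kv.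
- have [wr trw] := trP w; apply: (end_in_tail (k := n.+2) wr) => j.
  apply: conC rC; rewrite -vr; apply: ray_connected.
  by apply: tree_ray_avoid.
Qed.

End BreadthFirst.

(** * Parametrizing an arc *)

Section WeightedSum.
Variables (R : realType) (T : topologicalType) (phi : nat -> T -> R).
Hypothesis phic : forall n, continuous (phi n).
Hypothesis phi01 : forall n x, 0 <= phi n x <= 1.

Let w n : R := 2^-1 ^+ n.

Let w_gt0 n : 0 < w n. Proof. by rewrite exprn_gt0 // invr_gt0. Qed.

Let wS n : w n = w n.+1 + w n.+1.
Proof. by rewrite /w exprS; lra. Qed.

Fixpoint partial_sum n x : R :=
  if n is m.+1 then partial_sum m x + w n * phi m x else 0.

Let term n x : 0 <= w n.+1 * phi n x <= w n.+1.
Proof.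
have /andP[p0 p1] := phi01 n x.
by rewrite mulr_ge0 ?(ltW (w_gt0 _)) //= ler_piMr // ltW.
Qed.

Let psum_mono m n x : (m <= n)%N -> partial_sum m x <= partial_sum n x.
Proof.
move=> /subnK <-; elim: (n - m)%N => // k IH; rewrite addSn /=.
by apply: le_trans IH _; have /andP[] := term (k + m) x; rewrite lerDl.
Qed.

(** As [phi m] carries the weight [w m.+1], the total weight of all terms from index [m] on is
    [w m]. *)
Let psum_bound m n x : (m <= n)%N -> partial_sum n x + w n <= partial_sum m x + w m.
Proof.
move=> /subnK <-; elim: (n - m)%N => // k IH; rewrite addSn /=.
apply: le_trans IH; have /andP[_] := term (k + m) x; have := wS (k + m).
by rewrite /=; lra.
Qed.

Let psum_le m n x : partial_sum n x <= partial_sum m x + w m.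
Proof.
have [mn|/ltnW nm] := leqP m n.
  by have := psum_bound x mn; have := w_gt0 n; lra.
by have := psum_mono x nm; have := w_gt0 m; lra.
Qed.

(** The partial sums increase, so their supremum is the sum of the series. *)
Definition weighted_sum x : R := sup (range (partial_sum ^~ x)).

Let psum_ub n x : partial_sum n x <= weighted_sum x.
Proof.
apply: ub_le_sup; last by exists n.
by exists (partial_sum 0 x + w 0) => _ [m _ <-]; exact: psum_le.
Qed.

Let sum_le (c : R) x : (forall n, partial_sum n x <= c) -> weighted_sum x <= c.
Proof. by move=> h; apply: ge_sup => [|_ [n _ <-]//]; exists 0, 0%N. Qed.

Lemma weighted_sum_le x y : (forall n, phi n x <= phi n y) ->
  weighted_sum x <= weighted_sum y.
Proof.
move=> xy; apply: sum_le => n; apply: le_trans (psum_ub n y).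
by elim: n => //= n IH; apply: lerD => //; apply: ler_wpM2l => //; exact: ltW.
Qed.

(** The gaps between the partial sums never shrink, so the gain at index [n] survives in the
    limit. *)
Lemma weighted_sum_lt x y : (forall n, phi n x <= phi n y) ->
  (exists n, phi n x < phi n y) -> weighted_sum x < weighted_sum y.
Proof.
move=> xy [n lt_xy].
have incr k m : (k <= m)%N ->
    partial_sum k y - partial_sum k x <= partial_sum m y - partial_sum m x.
  move=> /subnK <-; elim: (m - k)%N => // j IH; rewrite addSn /=.
  have := ler_wpM2l (ltW (w_gt0 (j + k).+1)) (xy (j + k)%N); lra.
have d0 : 0 < w n.+1 * phi n y - w n.+1 * phi n x.
  by rewrite -mulrBr mulr_gt0 // subr_gt0.
suff : weighted_sum x <= weighted_sum y - (w n.+1 * phi n y - w n.+1 * phi n x) by lra.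
apply: sum_le => m; pose M := maxn m n.+1.
have := incr _ _ (leq0n n); have := incr n.+1 M (leq_maxr _ _).
have := psum_mono x (leq_maxl m n.+1); have := psum_ub M y.
by rewrite /= -/M; lra.
Qed.

Let psum_continuous n : continuous (partial_sum n).
Proof.
elim: n => [|n IH] x; first exact: cvg_cst.
by apply: cvgD; [exact: IH|apply: cvgM; [exact: cvg_cst|exact: phic]].
Qed.

Lemma weighted_sum_continuous : continuous weighted_sum.
Proof.
move=> x; apply/cvgrPdist_lt => eps eps0.
have [n wn] : exists n, w n < eps / 2.
  have : geometric 1 (2^-1 : R) @ \oo --> 0.
    by apply: cvg_geometric; rewrite ger0_norm ?invr_ge0 // invf_lt1 ?ltr1n.
  move=> /cvgrPdist_lt/(_ (eps / 2))[|N _ /(_ N (leqnn N))].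
    by rewrite divr_gt0.
  rewrite /= sub0r mul1r normrN ger0_norm; last exact: ltW (w_gt0 N).
  by exists N.
have := @psum_continuous n x; move=> /cvgrPdist_lt/(_ (eps / 2)).
have e20 : 0 < eps / 2 by rewrite divr_gt0.
move=> /(_ e20); apply: filterS => y; rewrite !ltr_norml.
have := psum_ub n x; have := psum_ub n y.
have := sum_le (fun m => psum_le n m x); have := sum_le (fun m => psum_le n m y).
by lra.
Qed.

End WeightedSum.

(** Here [rho] rescales [h]; compactness makes it a homeomorphism onto its image, and order density
    rules out gaps in the image. *)
Lemma compact_unit_arc (R : realType) (T : topologicalType) (K : set T)
    (h : T -> R) (s t : T) :
  compact K -> continuous h ->
  (forall x y, K x -> K y -> h x = h y -> x = y) ->
  K s -> K t -> h s < h t -> (forall x, K x -> h s <= h x <= h t) ->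
  (forall x y, K x -> K y -> h x < h y -> exists2 z, K z & h x < h z < h y) ->
  exists (sigma : R -> T) (rho : T -> R),
    [/\ homeo_unit_itv sigma rho K, sigma 0 = s, sigma 1 = t &
        forall x y, rho x < rho y <-> h x < h y].
Proof.
move=> cK hc hinj Ks Kt st hst hdense.
have l0 : 0 < h t - h s by rewrite subr_gt0.
pose rho x := (h x - h s) / (h t - h s).
have rhoc : continuous rho.
  move=> x; apply: cvgM; last exact: cvg_cst.
  by apply: cvgB; [exact: hc|exact: cvg_cst].
have rholt x y : rho x < rho y <-> h x < h y.
  by rewrite /rho ltr_pM2r ?invr_gt0 // ltrD2r.
have rhos : rho s = 0 by rewrite /rho subrr mul0r.
have rhot : rho t = 1 by rewrite /rho divff // gt_eqF.
have rho01 x : K x -> 0 <= rho x <= 1.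
  move=> /hst/andP[sx xt]; rewrite -rhos -rhot /rho.
  by rewrite !ler_pM2r ?invr_gt0 // !lerD2r sx.
have rhoinj x y : K x -> K y -> rho x = rho y -> x = y.
  move=> Kx Ky xy; apply: hinj => //; apply/eqP; rewrite eq_le !leNgt.
  by apply/andP; split; apply/negP => /rholt; rewrite xy ltxx.
have clo (A : set R) : closed A -> compact (K `&` rho @^-1` A).
  move=> cA; apply: compact_closedI => //.
  by apply: (@closed_comp _ _ rho) => // x _; exact: rhoc.
(* By compactness there are a highest point of [K] at or below [c] and a lowest one at or above [c];
   density forbids a gap between them. *)
have surj c : 0 <= c <= 1 -> exists2 x, K x & rho x = c.
  move=> /andP[c0 c1].
  have [|||x /set_mem[Kx xc] xmax] :=
    @compact_EVT_max _ _ rho (K `&` rho @^-1` [set y | y <= c]).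
  - by exists s; split => //=; rewrite rhos.
  - by apply: clo; exact: closed_le.
  - exact: continuous_subspaceT.
  have [|||y /set_mem[Ky cy] ymin] :=
    @compact_EVT_min _ _ rho (K `&` rho @^-1` [set y | c <= y]).
  - by exists t; split => //=; rewrite rhot.
  - by apply: clo; exact: closed_ge.
  - exact: continuous_subspaceT.
  have [xy|yx] := ltP (rho x) (rho y).
    have [z Kz /andP[/rholt xz /rholt zy]] := hdense x y Kx Ky ((rholt _ _).1 xy).
    have [zc|cz] := leP (rho z) c.
      by have := xmax z (mem_set (conj Kz zc)); rewrite leNgt xz.
    by have := ymin z (mem_set (conj Kz (ltW cz))); rewrite leNgt zy.
  by exists x => //; apply/eqP; rewrite eq_le xc (le_trans cy).
pose sigma c := xget s [set x | K x /\ rho x = c].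
have sigmaP c : 0 <= c <= 1 -> K (sigma c) /\ rho (sigma c) = c.
  move=> /surj[x Kx xc].
  have xP : exists x, [set x | K x /\ rho x = c] x by exists x.
  exact: (xgetPex s xP).
have sigmaK x : K x -> sigma (rho x) = x.
  by move=> Kx; have [Ks' xs] := sigmaP _ (rho01 _ Kx); exact: rhoinj.
exists sigma, rho; split=> //.
- split.
  + apply/seteqP; split=> [_ [c /= + <-]|x Kx].
      by rewrite in_itv /= => /sigmaP[].
    by exists (rho x); rewrite ?sigmaK //= in_itv /= rho01.
  + by move=> c; rewrite inE /= => /sigmaP[].
  + apply/subspace_continuousP => c; rewrite /= in_itv /= => c01 U.
    rewrite nbhsE => -[O [oO Oc] OU].
    (* Continuity of the inverse: [rho] maps the compact set [K] minus [O] to a closed set, whose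
       complement is the required neighbourhood. *)
    have cR : closed (rho @` (K `&` ~` O)).
      apply: compact_closed; first exact: norm_hausdorff.
      apply: continuous_compact; first exact: continuous_subspaceT.
      by apply: compact_closedI => //; exact: open_closedC.
    have nc : (~` (rho @` (K `&` ~` O))) c.
      move=> [x [Kx nOx] xc]; apply: nOx.
      by rewrite -(sigmaK x Kx) xc.
    have : nbhs c (~` (rho @` (K `&` ~` O))).
      by apply: open_nbhs_nbhs; split=> //; exact: closed_openC.
    apply: filterS => c' nc'; rewrite /= in_itv /= => c'01; apply: OU.
    have [Kc' cc'] := sigmaP _ c'01; apply: contrapT => nO; apply: nc'.
    by exists (sigma c').
  + exact: continuous_subspaceT.
- by rewrite -rhos sigmaK.
- by rewrite -rhot sigmaK.
Qed.

(** * Arcs and minimal edge sets *)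

Section ArcOfMinimal.
Variables (R : realType) (G : digraph).
Hypotheses (lf : locally_finite G) (wc : weakly_connected G).
Variables (s t : fpoint R G).
Hypotheses (sVO : VOmega R G s) (tVO : VOmega R G t) (st : s <> t).
Implicit Types (A B : set (edge G)) (X Y : set G) (e f : edge G).
Implicit Types (p q : fpoint R G).

Lemma VOmega_vertex p : VOmega R G p -> exists v : G, True.
Proof.
case=> [[v _ _]|[w _ _]]; first by exists v.
by have [r _] := gend_inhab w; exists (ray_vertex r 0%N).
Qed.

Lemma eclosure_compact A : compact (eclosure R A).
Proof.
have [o _] := VOmega_vertex sVO.
apply: subclosed_compact (@subsetT _ _); first exact: closed_closure.
exact: fpoint_compact lf wc o R.
Qed.

Lemma st_cut_exists : exists X, st_cut s t X.
Proof. by have [X [fX sX tX]] := side_separation lf sVO tVO st; exists X. Qed.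

(** Intersecting a cut with a set [D] around [s] gives a cut whose leaving edges start in [D]; for
    [t] the dual argument uses a union. *)
Lemma hits_adherent A : hits s t A -> adherent A s /\ adherent A t.
Proof.
move=> hA; have [Z cZ] := st_cut_exists.
split; split=> // D fD pD.
  have [e Ae [[_ Dt] _]] := hA _ (st_cutI cZ fD pD).
  by exists e => //; left.
have tD : side t (~` ~` D) by rewrite setCK.
have [e Ae [_ nh]] := hA _ (st_cutU cZ (fin_bdC fD) tD).
by exists e => //; right; apply: contrapT => nD; apply: nh; right.
Qed.

Lemma continuous_barrier (T : topologicalType) (a b : T -> R) :
  continuous a -> continuous b -> continuous (fun x => (1 - a x) * b x).
Proof.
move=> ca cb x; apply: cvgM; last exact: cb.
by apply: cvgB; [exact: cvg_cst|exact: ca].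
Qed.

Section Minimal.
Variable A : set (edge G).
Hypothesis minA : incl_minimal (hits s t) A.
Variable cut_of : edge G -> set G.
Hypothesis cut_ofP : forall e, A e -> tight s t A e (cut_of e).

Let K := eclosure R A.
Let chi e := cutfun (cut_of e) : fpoint R G -> R.

Let chi_continuous e : A e -> continuous (chi e).
Proof. by move=> /cut_ofP[[fX _ _] _ _]; exact: cutfun_continuous. Qed.

Lemma chi_edge e (x : R) : A e -> 0 <= x <= 1 -> chi e (edge_pt e x) = x.
Proof.
move=> /cut_ofP[_ [Xt nXh] _] x01.
by rewrite /chi cutfun_edge_pt // off0 // off1 //; lra.
Qed.

(** The alternative is the vanishing of a continuous product, which passes from the edges of [A] to
    the closure. *)
Lemma chi_precedes e f p : A e -> A f ->
  precedes A e (cut_of e) f (cut_of f) -> K p -> chi e p = 1 \/ chi f p = 0.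
Proof.
move=> Ae Af [p1 p2 p3 p4 p5] Kp.
suff /eqP : (1 - chi e p) * chi f p = 0.
  by rewrite mulf_eq0 subr_eq0 => /orP[/eqP<-|/eqP->]; [left|right].
move: p Kp; apply: eclosure_const.
  by apply: continuous_barrier; exact: chi_continuous.
move=> g x Ag x01; rewrite /chi !cutfun_edge_pt //.
have [_ _ oe] := cut_ofP Ae; have [_ _ of_] := cut_ofP Af.
have := oe g Ag; have := of_ g Ag; have := p5 g Ag.
have [->|ge] := EM (g = e).
  by move=> _ _ _; rewrite (off0 R p1) (off0 R p2); ring.
have [->|gf] := EM (g = f).
  by move=> _ _ _; rewrite (off1 R p3) (off1 R p4); ring.
move=> [h1 h2] /(_ gf) h3 /(_ ge) h4.
by case: (offP R (cut_of e) (etail g)) => -[? ->];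
  case: (offP R (cut_of e) (ehead g)) => -[? ->];
  case: (offP R (cut_of f) (etail g)) => -[? ->];
  case: (offP R (cut_of f) (ehead g)) => -[? ->]; try (exfalso; tauto); ring.
Qed.

(** Of two tight cut functions, the later is nonzero only where the earlier has reached 1, so they
    never move in opposite directions. *)
Lemma chi_mono e f p q : A e -> A f -> K p -> K q ->
  chi e p < chi e q -> chi f p <= chi f q.
Proof.
move=> Ae Af Kp Kq lt_pq; have [<-|ef] := EM (e = f); first exact: ltW.
have /andP[p0 p1] := cutfun_itv (cut_of f) p.
have /andP[q0 q1] := cutfun_itv (cut_of f) q.
have /andP[p0' p1'] := cutfun_itv (cut_of e) p.
have /andP[q0' q1'] := cutfun_itv (cut_of e) q.
have [pr|pr] := tight_compare minA Ae Af ef (cut_ofP Ae) (cut_ofP Af).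
  have [ep|->] := chi_precedes Ae Af pr Kp; last by [].
  by move: lt_pq; rewrite ep ltNge q1'.
have [->|eq0] := chi_precedes Af Ae pr Kq; first by [].
by move: lt_pq; rewrite eq0 ltNge p0'.
Qed.

Lemma chi01 e p : A e -> K p -> ~ range (Inner e) p -> chi e p = 0 \/ chi e p = 1.
Proof.
move=> Ae Kp np; have [fX _ _] := (let: And3 h _ _ := cut_ofP Ae in h).
have VO01 : VOmega R G p -> chi e p = 0 \/ chi e p = 1.
  move=> pVO; have [pX|pX] := side_total pVO fX.
    by left; exact: cutfun_side.
  by right; exact: cutfun_sideC.
case: p Kp np VO01 => [v _ _|f x Kf nf _|w _ _]; first by apply; left; exists v.
  have fe : f <> e by move=> fe; apply: nf; rewrite fe; exists x.
  have [_ _ /(_ f (inner_eclosure Kf) fe) fX'] := cut_ofP Ae.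
  rewrite /chi /=.
  by case: (offP R (cut_of e) (etail f)) => -[? ->];
    case: (offP R (cut_of e) (ehead f)) => -[? ->]; try (exfalso; tauto);
    [left|right]; ring.
by apply; right; exists w.
Qed.

(** An inner point is identified by the function of its own edge; vertices and ends are told apart
    by [tight_separation]. *)
Lemma chi_separates p q : K p -> K q -> p <> q ->
  exists2 e, A e & chi e p <> chi e q.
Proof.
have inner e x p' : K (Inner e x) -> K p' -> Inner e x <> p' ->
    exists2 f, A f & chi f (Inner e x) <> chi f p'.
  move=> Ke Kp' xp'; have Ae := inner_eclosure Ke; exists e => //.
  have x01 : 0 <= val x <= 1 by case: (x) => y /= /andP[? ?]; rewrite !ltW.
  rewrite -edge_pt_val chi_edge //.
  have [[y _ yp']|np'] := EM (range (Inner e) p').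
    have y01 : 0 <= val y <= 1 by case: (y) => z /= /andP[? ?]; rewrite !ltW.
    rewrite -yp' -edge_pt_val chi_edge // => xy; apply: xp'.
    by rewrite -yp' -(val_inj xy).
  case: x {Ke xp' x01} => x /= /andP[x0 x1].
  by have [->|->] := chi01 Ae Kp' np' => E; move: x0 x1; rewrite E ltxx.
move=> Kp Kq pq.
have [[e [x _ xp]]|np] := EM (exists e, range (Inner e) p).
  by subst p; exact: (inner e x q Kp Kq pq).
have [[e [x _ xq]]|nq] := EM (exists e, range (Inner e) q).
  subst q; have [f Af ne] := inner e x p Kq Kp (fun E => pq (esym E)).
  by exists f => // E; exact: ne (esym E).
have VO p' : ~ (exists e, range (Inner e) p') -> VOmega R G p'.
  case: p' => [v _|e x n|w _]; [by left; exists v| |by right; exists w].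
  by case: n; exists e, x.
have [e Ae ne] := tight_separation sVO tVO minA cut_ofP
  (eclosure_adherent (VO p np) Kp) (eclosure_adherent (VO q nq) Kq) pq lf.
exists e => //; have [fX _ _] := (let: And3 h _ _ := cut_ofP Ae in h).
have [pX|pX] := side_total (VO p np) fX; have [qX|qX] := side_total (VO q nq) fX.
- by case: ne.
- by rewrite /chi (cutfun_side pX) (cutfun_sideC fX qX) => /eqP; rewrite eq_sym oner_eq0.
- by rewrite /chi (cutfun_side qX) (cutfun_sideC fX pX) => /eqP; rewrite oner_eq0.
- by case: ne; split=> [pX'|qX']; [case: (side_excl fX pX' pX)|case: (side_excl fX qX' qX)].
Qed.

Lemma minimal_arc_of : directed_arc s t K.
Proof.
have [X0 cX0] := st_cut_exists; have [e0 Ae0 _] := minA.1 _ cX0.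
have [o _] := VOmega_vertex sVO.
have /countable_injP[idx idx_inj] := edge_countable lf wc o.
(* An enumeration of [A] with repetitions: indices not taken by an edge of [A] default to [e0]. *)
pose en n := xget e0 [set e | A e /\ idx e = n].
have Aen n : A (en n) by rewrite /en; case: xgetP => [e -> []|].
have enK e : A e -> exists n, en n = e.
  move=> Ae; exists (idx e); rewrite /en; case: xgetP => [f -> [_ fe]|/(_ e)].
    by apply: idx_inj; rewrite ?inE.
  by case.
pose phi n := chi (en n); pose h := weighted_sum phi.
have phi01 n x : 0 <= phi n x <= 1 by exact: cutfun_itv.
have phic n : continuous (phi n) by exact: chi_continuous.
have hc : continuous h by exact: weighted_sum_continuous.
have hlt e p q : A e -> K p -> K q -> chi e p < chi e q -> h p < h q.
  move=> Ae Kp Kq pq; apply: weighted_sum_lt => // [n|].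
    exact: (chi_mono Ae).
  by have [n en_e] := enK e Ae; exists n; rewrite /phi en_e.
have ltP p q : h p < h q -> exists2 e, A e & chi e p < chi e q.
  move=> pq; apply: contrapT => none; move: pq; rewrite ltNge => /negP; apply.
  apply: weighted_sum_le => // n; rewrite leNgt; apply/negP => lt_pq.
  by apply: none; exists (en n).
have chis e : A e -> chi e s = 0.
  by move=> /cut_ofP[[_ sX _] _ _]; exact: cutfun_side.
have chit e : A e -> chi e t = 1.
  by move=> /cut_ofP[[fX _ tX] _ _]; exact: cutfun_sideC.
have [sA tA] := hits_adherent minA.1.
have Ks : K s by exact: adherent_eclosure.
have Kt : K t by exact: adherent_eclosure.
have [||||||||sigma [rho [hom s0 s1 rholt]]] := @compact_unit_arc R _ K h s t.
- exact: eclosure_compact.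
- exact: hc.
- move=> p q Kp Kq pq; apply: contrapT => npq.
  have [e Ae /eqP] := chi_separates Kp Kq npq.
  rewrite neq_lt => /orP[lt_pq|lt_qp].
    by have := hlt e p q Ae Kp Kq lt_pq; rewrite pq ltxx.
  by have := hlt e q p Ae Kq Kp lt_qp; rewrite pq ltxx.
- exact: Ks.
- exact: Kt.
- by apply: (hlt e0) => //; rewrite chis // chit.
- move=> p Kp; apply/andP; split; apply: weighted_sum_le => // n.
    by rewrite /phi chis //; case/andP: (phi01 n p).
  by rewrite /phi chit //; case/andP: (phi01 n p).
(* Density: [chi e] is the parameter along [e], so the point of [e] at the mean height lies strictly
   between. *)
- move=> p q Kp Kq /ltP[e Ae pq]; pose x := (chi e p + chi e q) / 2.
  have /andP[p0 _] := cutfun_itv (cut_of e) p.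
  have /andP[_ q1] := cutfun_itv (cut_of e) q.
  have x01 : 0 <= x <= 1 by rewrite /x /chi in pq *; lra.
  have Kx : K (edge_pt e x) by exact: edge_pt_eclosure.
  by exists (edge_pt e x) => //; apply/andP; split; apply: (hlt e) => //;
    rewrite chi_edge // /x; lra.
exists sigma, rho; split=> // e p q [Kp [x _ xp]] [Kq [y _ yq]].
rewrite rholt; have Ae : A e by rewrite -xp in Kp; exact: inner_eclosure Kp.
have [x01 y01] : 0 < val x < 1 /\ 0 < val y < 1 := conj (valP x) (valP y).
have chip : chi e p = val x by rewrite -xp -edge_pt_val chi_edge //; lra.
have chiq : chi e q = val y by rewrite -yq -edge_pt_val chi_edge //; lra.
transitivity (val x < val y); split.
- move=> hpq; rewrite ltNge; apply/negP; rewrite le_eqVlt => /orP[/eqP yx|yx].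
    by move: hpq; rewrite -xp -yq (val_inj yx) ltxx.
  have : h q < h p by apply: (hlt e) => //; rewrite chip chiq.
  by move=> /lt_trans/(_ hpq); rewrite ltxx.
- by move=> xy; apply: (hlt e) => //; rewrite chip chiq.
- by move=> xy; exists (val x), (val y); rewrite !edge_pt_val; split=> //; lra.
- move=> [x' [y' [_ xy _]]]; rewrite -xp -yq -!edge_pt_val.
  by move=> /esym/(edge_pt_eq x01)[_ <-] /esym/(edge_pt_eq y01)[_ <-].
Qed.

End Minimal.

Lemma minimal_arc A : incl_minimal (hits s t) A -> directed_arc s t (eclosure R A).
Proof.
move=> minA; have /choice[cut_of cut_ofP] : forall e, exists X, A e -> tight s t A e X.
  move=> e; have [Ae|nAe] := EM (A e); last by exists setT.
  by have [X tX] := tight_exists minA Ae; exists X.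
exact: minimal_arc_of cut_ofP.
Qed.

(* The last point of the arc at height 1/2 of the cut function is the midpoint
   of a cut edge; just after it the arc is closer to t, so the edge is
   traversed from X to its complement. *)
Lemma arc_hits A : directed_arc s t (eclosure R A) -> hits s t A.
Proof.
move=> [sigma [rho [[img can sc rc] s0 s1 dir]]] X [fX sX tX].
set K := eclosure R A in img rc dir.
have K_sigma (c : R) : 0 <= c <= 1 -> K (sigma c).
  by move=> c01; rewrite -img; exists c => //=; rewrite in_itv.
have canc (c : R) : 0 <= c <= 1 -> rho (sigma c) = c.
  by move=> c01; apply: can; rewrite inE.
have chi_s : cutfun X s = 0 by exact: cutfun_side.
have chi_t : cutfun X t = 1 by exact: cutfun_sideC.
have chi_c := @cutfun_continuous R G X fX.
pose L := K `&` cutfun X @^-1` [set y | y <= 1 / 2].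
have [|||p /set_mem[Kp /= pX] pmax] := @compact_EVT_max _ _ rho L.
- exists s; split; last by rewrite /= chi_s; lra.
  by rewrite -s0; apply: K_sigma; rewrite lexx ler01.
- apply: compact_closedI; first exact: eclosure_compact.
  by apply: (@closed_comp _ _ (cutfun X)); [move=> x _; exact: chi_c|exact: closed_le].
- by apply: continuous_subspaceW rc => ? [].
have [tau tau01 sp] : exists2 tau : R, 0 <= tau <= 1 & sigma tau = p.
  by move: (Kp); rewrite -img => -[c /=]; rewrite in_itv; exists c.
have rp : rho p = tau by rewrite -sp canc.
have tau1 : tau < 1.
  rewrite lt_neqAle; case/andP: tau01 => _ ->; rewrite andbT; apply/eqP => t1.
  by move: pX; rewrite -sp t1 s1 chi_t; lra.
have after (c : R) : tau < c <= 1 -> 1 / 2 < cutfun X (sigma c).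
  move=> c1; have c01 : 0 <= c <= 1 by lra.
  rewrite ltNge; apply/negP => cX.
  have := pmax (sigma c) (mem_set (conj (K_sigma c c01) cX)).
  by rewrite canc // rp; lra.
have near_after U : nbhs p U -> exists2 c : R, tau < c <= 1 & U (sigma c).
  move=> pU; have tauI : (`[0, 1]%classic : set R) tau by rewrite /= in_itv.
  have {}pU : nbhs (sigma tau) U by rewrite sp.
  have := (subspace_continuousP _ _).1 sc tau tauI U pU => /nbhs_ballP[d /= d0 dU].
  exists (Num.min 1 (tau + d / 2)).
    by rewrite lt_min tau1 ge_min lexx /= andbT; lra.
  apply: dU; last first.
    by rewrite /= in_itv /= ge_min lexx le_min ler01 /=; lra.
  have [m1 m2] : Num.min 1 (tau + d / 2) <= tau + d / 2 /\ tau < Num.min 1 (tau + d / 2).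
    by rewrite ge_min lexx orbT lt_min tau1; split=> //=; lra.
  by rewrite /ball /= ltr_norml; lra.
(* Were [p] below height 1/2, so would be points of the arc just after it. *)
have pX2 : cutfun X p = 1 / 2.
  apply/eqP; rewrite eq_le pX leNgt; apply/negP => lt_p.
  have [|c c1 /=] := near_after (cutfun X @^-1` [set y | y < 1 / 2]).
    by apply: (chi_c p); apply: open_nbhs_nbhs; split=> //; exact: open_lt.
  by have := after c c1; lra.
have pVO : ~ VOmega R G p.
  move=> pVO; have [/cutfun_side|/(cutfun_sideC fX)] := side_total pVO fX.
    by rewrite pX2; lra.
  by rewrite pX2; lra.
case: p => [v|e x|w] in Kp pX pmax sp rp near_after pX2 pVO *.
- by case: pVO; left; exists v.
- exists e; first exact: inner_eclosure Kp.
  move: pX2 => /=.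
  have x01 : 0 < val x < 1 := valP x.
  case: (offP R X (etail e)) => -[Xt tE]; case: (offP R X (ehead e)) => -[Xh hE];
    rewrite tE hE => xE; [|by []| |];
    try by suff : (1 : R) <= 0; [rewrite ler10|lra].
  (* Remaining case: [e] enters [X], so the function falls along [e]. A nearby later point of the
     arc is higher, hence earlier on [e], against the direction of the arc. *)
  have [c c1] := near_after _ (inner_ball_nbhs e x ltr01).
  have c01 : 0 <= c <= 1 by lra.
  have := after c c1; have := K_sigma c c01.
  case sE : (sigma c) => [v|f y|w] //= Kc + [fe _]; subst f.
  rewrite tE hE => yX; have y01 : 0 < val y < 1 := valP y.
  have : rho (Inner e y) < rho (Inner e x).
    have Py : (K `&` range (Inner e)) (Inner e y) by split=> //; exists y.
    have Px : (K `&` range (Inner e)) (Inner e x) by split=> //; exists x.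
    apply/(dir e _ _ Py Px).
    exists (val y), (val x); rewrite !edge_pt_val; split=> //;
      by move: xE yX x01 y01 => /=; lra.
  by rewrite -sE canc // rp; lra.
- by case: pVO; right; exists w.
Qed.

(* A minimal subset of A meeting the cuts spans a subarc with the same ends,
   which is the whole arc. *)
Lemma arc_minimal A : directed_arc s t (eclosure R A) -> incl_minimal (hits s t) A.
Proof.
move=> arcA; split=> [|B BA hB]; first exact: arc_hits.
have [C CB minC] := hits_minimal hB.
have [sigma' [rho' [[img' _ sc' _] s0' s1' _]]] := minimal_arc minC.
have [sigma [rho [[img can sc rc] s0 s1 _]]] := arcA.
have CA : C `<=` A by exact: subset_trans BA.
have sub : eclosure R C `<=` eclosure R A.
  by apply: closure_subset => p [e Ce ep]; exists e => //; exact: CA.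
have canc (c : R) : 0 <= c <= 1 -> rho (sigma c) = c.
  by move=> c01; apply: can; rewrite inE.
have K'_sigma (c : R) : 0 <= c <= 1 -> eclosure R C (sigma' c).
  by move=> c01; rewrite -img'; exists c => //=; rewrite in_itv.
apply/seteqP; split=> // e Ae; apply: CB.
(* The midpoint of [e] detects membership: if it lies in the closure of [C], then [e] is in [C]. *)
have h01 : 0 <= (2^-1 : R) <= 1 by lra.
have h01' : 0 < (2^-1 : R) < 1 by lra.
have := edge_pt_eclosure Ae h01; rewrite -img => -[c /=]; rewrite in_itv /= => c01 ce.
have rs : rho s = 0 by rewrite -s0 canc // lexx ler01.
have rt : rho t = 1 by rewrite -s1 canc // lexx ler01.
(* In the parameter of the whole arc, the subarc runs continuously from 0 to 1, so it passes through
   the parameter [c] of the midpoint. *)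
have [|||d d01 dc] := @IVT R (rho \o sigma') 0 1 c.
- exact: ler01.
- apply/subspace_continuousP => x x01 U.
  have KI y : (`[0, 1]%classic : set R) y -> eclosure R A (sigma' y).
    by rewrite /= in_itv => y01; apply: sub; exact: K'_sigma.
  move=> UN.
  have V : nbhs (sigma' x) [set q | eclosure R A q -> U (rho q)].
    exact: ((subspace_continuousP _ _).1 rc _ (KI x x01) U UN).
  have W : nbhs x [set y | (`[0, 1]%classic : set R) y ->
      eclosure R A (sigma' y) -> U (rho (sigma' y))].
    exact: ((subspace_continuousP _ _).1 sc' x x01 _ V).
  suff : nbhs x [set y | (`[0, 1]%classic : set R) y -> U (rho (sigma' y))] by [].
  by apply: filterS W => y /= yU y01; apply: yU => //; exact: KI.
- by rewrite /= s0' s1' rs rt (min_idPl ler01) (max_idPr ler01).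
have {}d01 : 0 <= d <= 1 by move: d01; rewrite in_itv.
have : eclosure R C (edge_pt e 2^-1).
  suff <- : sigma' d = edge_pt e 2^-1 by exact: K'_sigma.
  have := sub _ (K'_sigma d d01); rewrite -img => -[d' /=]; rewrite in_itv /= => d'01 dd.
  by rewrite -dd -ce; congr sigma; rewrite -dc /= -dd canc.
by rewrite (edge_pt_inner e h01') => /inner_eclosure.
Qed.

(** The second class of a cut is the complement of the first, both are nonempty because [s] and [t]
    lie on them, and closures become sides by [vclosureE]. *)
Lemma finite_cut_forall (P : set G -> set G -> Prop) :
  (forall X Y, finite_cut X Y -> vclosure R X s -> vclosure R Y t -> P X Y) <->
  (forall X, st_cut s t X -> P X (~` X)).
Proof.
split=> [h X [fX sX tX]|h X Y [[_ _ XY0 XYT] fX] sX tY].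
  have sX' : vclosure R X s by apply/vclosureE.
  have tX' : vclosure R (~` X) t by apply/vclosureE => //; exact: fin_bdC.
  apply: h => //.
  split=> //; split; [exact: side_neq0 sX|exact: side_neq0 tX|exact: setICr|exact: setUv].
have E : Y = ~` X.
  apply/seteqP; split=> v; last by have : (X `|` Y) v; [rewrite XYT|case].
  by move=> Yv Xv; have : (X `&` Y) v by []; rewrite XY0.
subst Y; apply: h; have fXC := fin_bdC fX.
by split; [|exact: (vclosureE sVO fX).1 sX|exact: (vclosureE tVO fXC).1 tY].
Qed.

Lemma meets_cutsE A : meets_cuts s t A <-> hits s t A.
Proof.
rewrite /meets_cuts (finite_cut_forall (fun X Y => 1 <= ecard (A `&` dedges X Y))%N).
have fin X : st_cut s t X -> finite_set (A `&` dedges X (~` X)).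
  by move=> [fX _ _]; apply: sub_finite_set fX => e [_ ?]; left.
split=> h X cX; have := h X cX.
  by rewrite ecard_gt0; [move=> [e [Ae lXe]]; exists e|exact: fin].
by move=> [e Ae lXe]; rewrite ecard_gt0; [exists e|exact: fin].
Qed.

Lemma balances_cutsE A : balances_cuts s t A <->
  forall X, st_cut s t X ->
    ecard (A `&` dedges X (~` X)) = (ecard (A `&` dedges (~` X) X) + 1)%N.
Proof.
exact: (finite_cut_forall
  (fun X Y => ecard (A `&` dedges X Y) = (ecard (A `&` dedges Y X) + 1)%N)).
Qed.

Lemma balances_hits A : balances_cuts s t A -> hits s t A.
Proof.
rewrite balances_cutsE -meets_cutsE => bA.
apply/(finite_cut_forall (fun X Y => 1 <= ecard (A `&` dedges X Y))%N) => X /bA ->.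
by rewrite addn1.
Qed.

Lemma minimal_balances A : incl_minimal (hits s t) A -> balances_cuts s t A.
Proof. by move=> minA; apply/balances_cutsE; exact: minimal_balanced. Qed.

(** Balanced sets hit all cuts and minimal hitting sets are balanced, so a minimal balanced set
    equals any minimal hitting set inside it. *)
Lemma minimal_hits_balances A :
  incl_minimal (hits s t) A <-> incl_minimal (balances_cuts s t) A.
Proof.
split=> [minA|[bA minA]].
  split=> [|B BA bB]; first exact: minimal_balances.
  by apply: minA.2 => //; exact: balances_hits.
have [B BA minB] := hits_minimal (balances_hits bA).
by have <- := minA B BA (minimal_balances minB).
Qed.

End ArcOfMinimal.

Theorem lemma3p2 (R : realType) (G : digraph)
    (G_lf : locally_finite G) (G_conn : weakly_connected G)
    (s t : fpoint R G) (sVO : VOmega R G s) (tVO : VOmega R G t) (st : s <> t)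
    (A : set (edge G)) :
  (directed_arc s t (eclosure R A) <-> incl_minimal (meets_cuts s t) A) /\
  (incl_minimal (meets_cuts s t) A <-> incl_minimal (balances_cuts s t) A).
Proof.
have -> : meets_cuts s t = hits s t.
  by apply/funext => B; apply/propext; exact: meets_cutsE.
split; last exact: minimal_hits_balances.
by split; [exact: arc_minimal|exact: minimal_arc].
Qed.
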